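(* Let $X$ and $Y$ be complex Banach spaces. Suppose that $p\in D_{+}([0,1])$, $q\in\mathcal{P}([0,1])$, $1/p(x)+1/q(x)=1$, and $(R(t))_{t>0}\subseteq L(X,Y)$ is a strongly continuous operator family satisfying $$M:=\sum_{k=0}^{\infty}\|R(\cdot+k)\|_{L^{q(x)}[0,1]}<\infty.$$ Let $g:\mathbb{R}\to X$ be such that $\check g:\mathbb{R}\to X$ is $S^{p(x)}$-almost automorphic. Then the function $G:\mathbb{R}\to Y$ given by $$G(t):=\int_{-\infty}^{t}R(t-s)g(s)\,ds,\quad t\in\mathbb{R},$$ is well-defined and almost automorphic.
   Context: $L(X,Y)$ is the space of continuous linear maps $X\to Y$; $\check g(t):=g(-t)$ for $t\in\mathbb{R}$. Strong continuity of $(R(t))_{t>0}$ means that $t\mapsto R(t)x$, $t>0$, is continuous for each $x\in X$. $\|R(\cdot+k)\|_{L^{q(x)}[0,1]}$ is the $L^{q(x)}[0,1]$-norm of the scalar function $x\mapsto\|R(x+k)\|_{L(X,Y)}$. Convention: $1/\infty=0$. A continuous function $F:\mathbb{R}\to Y$ is almost automorphic iff for every real sequence $(b_n)$ there exist a subsequence $(a_n)$ of $(b_n)$ and a map $h:\mathbb{R}\to Y$ such that $\lim_{n\to\infty}F(t+a_n)=h(t)$ and $\lim_{n\to\infty}h(t-a_n)=F(t)$ pointwise for $t\in\mathbb{R}$. Variable exponent spaces. $\mathcal{P}([0,1])$ is the set of all Lebesgue measurable functions $p:[0,1]\to[1,\infty]$. With $p^{-}:=\operatorname{essinf}_{x\in[0,1]}p(x)$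 and $p^{+}:=\operatorname{esssup}_{x\in[0,1]}p(x)$, $D_{+}([0,1])$ is the set of measurable real-valued $p$ on $[0,1]$ with $1\le p^{-}\le p(x)\le p^{+}<\infty$ for a.e. $x$. For $p\in\mathcal{P}([0,1])$ and $t\ge 0$ put $\varphi_{p(x)}(t)=t^{p(x)}$ if $p(x)<\infty$; if $p(x)=\infty$, put $\varphi_{p(x)}(t)=0$ for $0\le t\le 1$ and $\varphi_{p(x)}(t)=\infty$ for $t>1$. For measurable $u:[0,1]\to X$ let $\rho(u)=\int_0^1\varphi_{p(x)}(\|u(x)\|)\,dx$. The space $L^{p(x)}([0,1]:X)$ consists of all measurable $u:[0,1]\to X$ with $\rho(\lambda u)<\infty$ for some $\lambda>0$ (functions equal a.e. identified), with the Luxemburg norm $\|u\|_{L^{p(x)}([0,1]:X)}=\inf\{\lambda>0:\rho(u/\lambda)\le 1\}$; $L^{p(x)}[0,1]$ denotes the scalar case. $L_S^{p(x)}(\mathbb{R}:X)$ is the space of measurable $f:\mathbb{R}\to X$ such that $f(\cdot+t)\in L^{p(x)}([0,1]:X)$ for all $t\in\mathbb{R}$ and $\sup_{t\in\mathbb{R}}\|f(\cdot+t)\|_{L^{p(x)}([0,1]:X)}<\infty$. A function $f\in L_S^{p(x)}(\mathbb{R}:X)$ is $S^{p(x)}$-almost automorphic iff for every real sequence $(a_n)$ there exist a subsequence $(a_{n_k})$ and $h\in L_S^{p(x)}(\mathbb{R}:X)$ such that, for each $t\in\mathbb{R}$, $\lim_{k\to\infty}\|f(a_{n_k}+\cdot+t)-h(\cdot+t)\|_{L^{p(x)}([0,1]:X)}=0$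 and $\lim_{k\to\infty}\|h(\cdot-a_{n_k}+t)-f(\cdot+t)\|_{L^{p(x)}([0,1]:X)}=0$. *)

(* Defs.v *)
From HB Require Import structures.
From mathcomp Require Import all_boot all_order all_algebra complex.
From mathcomp Require Import all_classical all_reals all_analysis.
From mathcomp Require Import measurable_realfun ess_sup_inf.

Set Implicit Arguments.
Unset Strict Implicit.
Unset Printing Implicit Defensive.

Import Order.TTheory GRing.Theory Num.Theory.
Import numFieldNormedType.Exports.

Local Open Scope classical_set_scope.
Local Open Scope ring_scope.
Local Open Scope complex_scope.

(* A complex Banach space over the realType R is a completeNormedModType R[i].
   Its library norm takes values in R[i]; normr_of is the same norm read in R. *)
Definition normr_of (R : realType) (E : normedModType R[i]) (x : E) : R :=
  complex.Re `|x|.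

Definition opnorm (R : realType) (X Y : normedModType R[i]) (A : X -> Y) : R :=
  sup [set normr_of (A x) | x in [set x : X | normr_of x <= 1]].

(* R with its sigma-algebra of Lebesgue (not just Borel) measurable sets. *)
Definition lebesgueR (R : realType) : measurableType _ :=
  caratheodory_type ((@wlength R idfun)^*)%mu.

Definition leb (R : realType) : {measure set (lebesgueR R) -> \bar R} :=
  @completed_lebesgue_measure R.
Arguments leb {R}.

Definition I01 (R : realType) : set (lebesgueR R) := `[0%R, 1%R].
Arguments I01 {R}.

Lemma measurable_I01 (R : realType) : measurable (@I01 R).
Proof.
have h : measurable (`[0%R, 1%R]%classic : set (measurableTypeR R)).
  exact: measurable_itv.
exact: sub_caratheodory.
Qed.

Definition leb01 (R : realType) : {measure set (lebesgueR R) -> \bar R} :=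
  mrestr leb (@measurable_I01 R).
Arguments leb01 {R}.

(* Measurability of vector-valued functions is strong measurability; the values
   of f outside D play no role. *)
Section bochner.
Context {R : realType} {d : measure_display} {T : measurableType d}.
Context {E : normedModType R[i]}.
Variable mu : {measure set T -> \bar R}.
Implicit Types (D : set T) (f : T -> E).

Definition simple_fun (s : T -> E) : Prop :=
  finite_set (range s) /\ forall y, measurable (s @^-1` [set y]).

Definition strongly_measurable D f : Prop :=
  exists s : nat -> T -> E, (forall n, simple_fun (s n)) /\
    {ae mu, forall x, D x -> s n x @[n --> \oo] --> f x}.

Definition integrable_simple_fun D (s : T -> E) : Prop :=
  simple_fun s /\
  forall y, y != 0 -> (mu (D `&` s @^-1` [set y]) < +oo)%E.

(* The term y = 0 contributes 0 even when its level set has infinite measure. *)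
Definition simple_integral D (s : T -> E) : E :=
  \sum_(y \in range s) (fine (mu (D `&` s @^-1` [set y])))%:C *: y.

Definition bochner_approx D f (s : nat -> T -> E) : Prop :=
  (forall n, integrable_simple_fun D (s n)) /\
  (\int[mu]_(x in D) (normr_of (f x - s n x))%:E)%E @[n --> \oo] --> 0%E.

Definition bochner_integrable D f : Prop :=
  strongly_measurable D f /\ exists s : nat -> T -> E, bochner_approx D f s.

Definition is_bochner_integral D f (I : E) : Prop :=
  strongly_measurable D f /\
  exists2 s : nat -> T -> E, bochner_approx D f s &
             simple_integral D (s n) @[n --> \oo] --> I.

Definition bochner_integral D f : E := get (is_bochner_integral D f).

End bochner.

Section variable_exponent.
Context {R : realType}.
Local Open Scope ereal_scope.

Definition exponent_P (p : R -> \bar R) : Prop :=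
  measurable_fun I01 (p : lebesgueR R -> \bar R) /\
  forall x : R, I01 x -> 1 <= p x.

Definition exponent_inf (p : R -> R) : \bar R :=
  ess_inf leb01 (EFin \o p : lebesgueR R -> \bar R).

Definition exponent_sup (p : R -> R) : \bar R :=
  ess_sup leb01 (EFin \o p : lebesgueR R -> \bar R).

Definition exponent_Dplus (p : R -> R) : Prop :=
  [/\ measurable_fun I01 (p : lebesgueR R -> R),
      1 <= exponent_inf p,
      {ae leb, forall x : R, I01 x ->
         exponent_inf p <= (p x)%:E <= exponent_sup p} &
      exponent_sup p < +oo].

(* The case p = -oo is a junk value: exponents are at least 1. *)
Definition phi (p : \bar R) (t : R) : \bar R :=
  match p with
  | r%:E => (t `^ r)%:E
  | +oo => if (t <= 1)%R then 0 else +oo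
  | -oo => 0
  end.

Context {E : normedModType R[i]}.
Implicit Types (p : R -> \bar R) (u f : R -> E).

Definition modular p u : \bar R :=
  \int[leb]_(x in I01) phi (p x) (normr_of (u x)).

Definition memLp p u : Prop :=
  strongly_measurable leb I01 u /\
  exists2 l : R, (0 < l)%R & modular p (fun x => l%:C *: u x)%R < +oo.

(* Equal to +oo when no scaling of u has modular at most 1. *)
Definition luxemburg p u : \bar R :=
  ereal_inf [set l%:E | l in
    [set l : R | (0 < l)%R /\ modular p (fun x => l^-1%:C *: u x)%R <= 1]].

Definition memLSp p f : Prop :=
  [/\ strongly_measurable leb setT f,
      forall t : R, memLp p (fun x => f (x + t)%R) &
      ereal_sup (range (fun t : R => luxemburg p (fun x => f (x + t)%R)))
        < +oo].

Definition Sp_almost_automorphic p f : Prop :=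
  memLSp p f /\
  forall a : nat -> R, exists k : nat -> nat, exists h : R -> E,
    [/\ {homo k : m n / (m < n)%N}, memLSp p h &
        forall t : R,
          luxemburg p (fun x => f (a (k n) + x + t) - h (x + t))%R
            @[n --> \oo] --> 0 /\
          luxemburg p (fun x => h (x - a (k n) + t) - f (x + t))%R
            @[n --> \oo] --> 0].

End variable_exponent.

Definition almost_automorphic (R : realType) (E : normedModType R[i])
    (F : R -> E) : Prop :=
  continuous F /\
  forall b : nat -> R, exists k : nat -> nat, exists h : R -> E,
    {homo k : m n / (m < n)%N} /\
    forall t : R, F (t + b (k n)) @[n --> \oo] --> h t /\
                  h (t - b (k n)) @[n --> \oo] --> F t.

(* Main.v *)
Require Import Defs.
From HB Require Import structures.
From mathcomp Require Import all_boot all_order all_algebra complex.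
From mathcomp Require Import all_classical all_reals all_analysis.
From mathcomp Require Import measurable_realfun ess_sup_inf.
From mathcomp Require Import ring lra.

(** Write f for the reflected function g(- .). The substitution u = t - s gives
    G(t) = K(f(. - t)), where K(v) is the integral of R(u) v(u) over u > 0
    (convolutionP). So everything reduces to the operator K.

    On a unit cell [k, k+1] Young's inequality for the conjugate exponents p(x)
    and q(x) bounds the integral of |R(u)| |v(u)| by twice the product of the
    Luxemburg norms of R(. + k) and v(. + k) (luxemburg_hoelder). Since the norms
    of the R(. + k) are summable, K(v) converges absolutely as soon as the norms
    of the v(. + k) are bounded (kernel_integrable), and by dominated convergence
    for series K(v_n) tends to K(w) when, in addition, v_n(. + k) tends to
    w(. + k) for every k (kernel_integral_cvg). If f(. - b_n + t) tends to
    h(. + t) for every t, then G(t + b_n) tends to H(t) = K(h(. - t)), and the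
    same argument with f and h exchanged gives H(t - b_n) -> G(t).

    Continuity of G is not a consequence of continuity of translations, which
    may fail in a space with variable exponent. It follows from almost
    automorphy itself: if s_n -> 0, a subsequence of f(. - s_n) converges, in the
    norm of every unit cell, to some h; it then converges in L^1 on each cell,
    and the only possible L^1 limit of translates of f by a null sequence is f
    (translate_limit_unique, an argument in the manner of Steinhaus). Hence h = f
    almost everywhere and G(t0 + s_n) tends to K(h(. - t0)) = G(t0) along the
    subsequence (convolution_continuous).

    The vector-valued part rests on two facts. A function is strongly measurable
    as soon as it is essentially separably valued and its distances to points
    are measurable (pettis); this applies to R(u) v(u)
    (strongly_measurable_apply). And two Bochner integrals differ by at most the
    integral of the norm of the difference (bochner_integral_le_dist), which
    yields existence, uniqueness and all the limits at once. *)

Import Order.TTheory GRing.Theory Num.Theory.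
Import numFieldNormedType.Exports.

Local Open Scope classical_set_scope.
Local Open Scope ring_scope.
Local Open Scope complex_scope.

Set Implicit Arguments.
Unset Strict Implicit.
Unset Printing Implicit Defensive.

(** * The real-valued norm of a complex normed space *)

Section normr_of_theory.
Context {R : realType} {E : normedModType R[i]}.
Implicit Types x y z : E.

Lemma normr_ofE x : `|x| = (normr_of x)%:C.
Proof. by rewrite /normr_of RRe_real// normr_real. Qed.

Lemma normr_of_ge0 x : 0 <= normr_of x.
Proof. by rewrite -ler0c -normr_ofE. Qed.

Lemma normr_of0 : normr_of (0 : E) = 0.
Proof. by rewrite /normr_of normr0. Qed.

Lemma normr_of_eq0 x : normr_of x = 0 -> x = 0.
Proof. by move=> x0; apply/eqP; rewrite -normr_eq0 normr_ofE x0. Qed.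

Lemma normr_of_gt0 x : x != 0 -> 0 < normr_of x.
Proof.
move=> x0; rewrite lt_neqAle normr_of_ge0 andbT eq_sym.
by apply: contra_neq x0; exact: normr_of_eq0.
Qed.

Lemma normr_ofN x : normr_of (- x) = normr_of x.
Proof. by rewrite /normr_of normrN. Qed.

Lemma normr_ofB x y : normr_of (x - y) = normr_of (y - x).
Proof. by rewrite /normr_of distrC. Qed.

Lemma normr_ofD x y : normr_of (x + y) <= normr_of x + normr_of y.
Proof. by rewrite -lecR rmorphD/= -!normr_ofE ler_normD. Qed.

Lemma normr_of_tri z x y : normr_of (x - y) <= normr_of (x - z) + normr_of (z - y).
Proof. by apply: le_trans (normr_ofD _ _); rewrite addrA subrK. Qed.

Lemma normr_of_dist x y : `|normr_of x - normr_of y| <= normr_of (x - y).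
Proof.
rewrite ler_norml; apply/andP; split.
  rewrite lerNl opprB lerBlDr normr_ofB.
  by apply: le_trans (normr_ofD _ _); rewrite subrK.
by rewrite lerBlDr; apply: le_trans (normr_ofD _ _); rewrite subrK.
Qed.

Lemma normr_ofZ (l : R) x : normr_of (l%:C *: x) = `|l| * normr_of x.
Proof.
apply: complexI; rewrite -normr_ofE normrZ normr_ofE rmorphM/=; congr (_ * _).
by rewrite normc_def/= expr0n addr0 sqrtr_sqr.
Qed.

Lemma normr_of_cvgP {T : Type} (F : set_system T) {FF : Filter F} (f : T -> E) l :
  f x @[x --> F] --> l <->
  (forall e : R, 0 < e -> \forall x \near F, normr_of (l - f x) < e).
Proof.
split=> [/cvgrPdist_lt h e e0|h].
  have := h e%:C; rewrite ltcR => /(_ e0).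
  by apply: filterS => x; rewrite normr_ofE ltcR.
apply/cvgrPdist_lt => -[e1 e2]; rewrite ltcE/= => /andP[/eqP-> e0].
by have := h _ e0; apply: filterS => x; rewrite normr_ofE ltcR.
Qed.

Lemma normr_of_cvg {T : Type} (F : set_system T) {FF : Filter F} (f : T -> E) l :
  f x @[x --> F] --> l -> normr_of (f x) @[x --> F] --> normr_of l.
Proof.
move=> /normr_of_cvgP h; apply/cvgrPdist_lt => e /h.
by apply: filterS => x; apply: le_lt_trans; exact: normr_of_dist.
Qed.

End normr_of_theory.

Lemma normr_of_real {R : realType} (r : R) :
  normr_of (r%:C : R[i]^o) = `|r|.
Proof. by rewrite /normr_of normc_def/= expr0n addr0 sqrtr_sqr. Qed.

(** * Translations and reflections of Lebesgue measure *)

Section lebesgue_reflection.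
Context {R : realType}.
Local Notation mustar := ((@wlength R idfun)^*)%mu.
Implicit Types (A : set R) (c x : R).

Lemma leb_complete : measure_is_complete (@leb R).
Proof. exact: completed_lebesgue_measure_is_complete. Qed.

Lemma lebE A : leb A = mustar A. Proof. by []. Qed.

Let reflect_wlength c (I : set R) : (exists ab : R * R, I = `]ab.1, ab.2[%classic) ->
  (exists ab : R * R, [set x : R | I (c - x)] = `]ab.1, ab.2[%classic) /\
  wlength idfun [set x : R | I (c - x)] = wlength idfun I.
Proof.
move=> [[a b] /= ->].
have -> : [set x : R | `]a, b[%classic (c - x)] = `](c - b), (c - a)[%classic.
  apply/seteqP; split => x /=; rewrite !in_itv/= => /andP[? ?]; apply/andP.
    by split; lra.
  by split; lra.
split; first by exists (c - b, c - a).
rewrite !wlength_itv/= !lte_fin.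
have -> : (c - b < c - a) = (a < b) by apply/idP/idP => ?; lra.
by case: ifP => // _; rewrite -!EFinB; congr (_%:E); lra.
Qed.

(** A reflection carries a cover by open intervals to one of the same total
    length. As a translation is a product of two reflections, reflections are
    the only case that needs an argument about covers. *)
Lemma outer_reflect_le c A : (mustar [set x : R | A (c - x)%R] <= mustar A)%E.
Proof.
rewrite [leRHS]outer_measure_open_itv_cover; apply: le_ereal_inf_tmp.
move=> _ [F [Fi AF] <-].
rewrite outer_measure_open_itv_cover; apply: ereal_inf_lbound => /=.
exists (fun k => [set x : R | F k (c - x)]); first split.
- by move=> k; exact: (reflect_wlength c (Fi k)).1.
- by move=> x /AF [k _ Fk]; exists k.
- by apply: eq_eseriesr => k _; exact: (reflect_wlength c (Fi k)).2.
Qed.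

Lemma outer_reflect c A : mustar [set x : R | A (c - x)] = mustar A.
Proof.
apply/eqP; rewrite eq_le outer_reflect_le/=.
have := outer_reflect_le c [set x : R | A (c - x)].
by congr (mustar _ <= _)%E; apply/seteqP; split => x /=; rewrite subKr.
Qed.

Lemma leb_measurable_reflect c A :
  measurable (A : set (lebesgueR R)) ->
  measurable ([set x : R | A (c - x)] : set (lebesgueR R)).
Proof.
move=> mA.
suff : caratheodory_measurable mustar [set x : R | A (c - x)] by [].
move=> X.
have h Z : mustar (Z `&` [set x : R | A (c - x)]) =
           mustar ([set x : R | Z (c - x)] `&` A).
  rewrite -(outer_reflect c ([set x : R | Z (c - x)] `&` A)).
  by congr mustar; apply/seteqP; split => x /=; rewrite subKr.
rewrite h -(outer_reflect c X) ((mA : caratheodory_measurable mustar A) [set x : R | X (c - x)]); congr (_ + _)%E.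
rewrite -[RHS](outer_reflect c).
by congr mustar; apply/seteqP; split => x /=; rewrite subKr.
Qed.

Lemma leb_reflect c A : leb [set x : R | A (c - x)] = leb A.
Proof. exact: outer_reflect. Qed.

Lemma leb_measurable_shift c A :
  measurable (A : set (lebesgueR R)) ->
  measurable ([set x : R | A (x + c)] : set (lebesgueR R)).
Proof.
move=> /(leb_measurable_reflect c)/(leb_measurable_reflect 0).
by congr measurable; apply/seteqP; split => x /=; rewrite sub0r opprK addrC.
Qed.

Lemma leb_shift c A : leb [set x : R | A (x + c)] = leb A.
Proof.
rewrite -(leb_reflect c A) -(leb_reflect 0 [set x : R | A (c - x)]); congr (leb _).
by apply/seteqP; split => x /=; rewrite sub0r opprK addrC.
Qed.

Lemma borel_leb_measurable A :
  measurable (A : set (measurableTypeR R)) ->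
  measurable (A : set (lebesgueR R)).
Proof. exact: sub_caratheodory. Qed.

Lemma leb_measurable_itv (i : interval R) :
  measurable ([set` i] : set (lebesgueR R)).
Proof. by apply: borel_leb_measurable; exact: measurable_itv. Qed.

Lemma leb_measurable_open A : open A -> measurable (A : set (lebesgueR R)).
Proof. by move=> ?; apply: borel_leb_measurable; exact: open_measurable. Qed.

Lemma leb_itv_oo (a b : R) : leb `]a, b[%classic = (Order.max 0 (b - a))%:E.
Proof.
transitivity (@lebesgue_measure R `]a, b[%classic) => //.
rewrite lebesgue_measure_itv/= lte_fin; case: ltP => ab.
  by rewrite -EFinB; congr _%:E; rewrite max_r//; lra.
by rewrite max_l//; lra.
Qed.

Lemma leb_I01 : leb (@I01 R) = 1%E.
Proof.
transitivity (@lebesgue_measure R `[0, 1]%classic) => //.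
by rewrite lebesgue_measure_itv/= lte_fin ltr01 -EFinB subr0.
Qed.

End lebesgue_reflection.

(** * Strong measurability *)

Section measurability_of_simple_functions.
Context {R : realType} {d : measure_display} {T : measurableType d}.
Variable mu : {measure set T -> \bar R}.
Implicit Types D A : set T.

(** Completeness makes the part of any preimage that lies in the exceptional
    null set measurable. *)
Lemma ae_measurable_fun_cvg D (h : nat -> T -> R) (f : T -> R) :
  measure_is_complete mu -> measurable D ->
  (forall n, measurable_fun D (h n)) ->
  {ae mu, forall x, D x -> h ^~ x @ \oo --> f x} ->
  measurable_fun D f.
Proof.
move=> cmu mD mh [N [mN N0 subN]] _ B mB.
have mDN : measurable (D `\` N) by exact: measurableD.
have mf : measurable_fun (D `\` N) f.
  apply: (@measurable_fun_cvg _ _ _ _ h).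
    by move=> n; apply: measurable_funS (mh n) => //; exact: subDsetl.
  move=> x [Dx Nx]; apply: contrapT => hx; apply: Nx; apply: subN => /=.
  by move=> /(_ Dx).
rewrite (_ : _ `&` _ = ((D `\` N) `&` f @^-1` B) `|` (D `&` N `&` f @^-1` B)).
  apply: measurableU; first exact: mf.
  by apply: cmu; exists N; split => // x [[]].
by rewrite -setIUl setDE -setIUr setUC setUCr setIT.
Qed.

Context {E : normedModType R[i]}.
Implicit Types s t : T -> E.

Lemma simple_fun_preimage s (B : set E) : simple_fun s -> measurable (s @^-1` B).
Proof.
move=> [fs ms].
have -> : s @^-1` B = \bigcup_(y in range s `&` B) s @^-1` [set y].
  apply/seteqP; split => [x Bx|x [y [_ By] /= ->]] //.
  by exists (s x) => //; split => //; exists x.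
by apply: fin_bigcup_measurable => //; apply: finite_setI; left.
Qed.

(** Freezing the first argument of psi on each of the finitely many level sets
    of s. *)
Lemma measurable_fun_simple s D (psi : E -> T -> R) : simple_fun s ->
  (forall y, measurable_fun D (psi y)) ->
  measurable_fun D (fun x => psi (s x) x).
Proof.
move=> [fs ms] mpsi mD B mB.
have -> : D `&` (fun x => psi (s x) x) @^-1` B =
  \bigcup_(y in range s) (s @^-1` [set y] `&` (D `&` psi y @^-1` B)).
  apply/seteqP; split => [x [Dx Bx]|x [y _ [/= <- []]]] //.
  by exists (s x) => //; exists x.
apply: fin_bigcup_measurable => // y _.
by apply: measurableI => //; exact: mpsi.
Qed.

Lemma simple_fun_cst (y : E) : simple_fun (fun _ : T => y).
Proof.
split; first by apply: (sub_finite_set _ (finite_set1 y)) => _ [x _ <-].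
move=> z; have [->|yz] := eqVneq y z.
  by rewrite (_ : _ @^-1` _ = setT)//; apply/seteqP; split.
by rewrite (_ : _ @^-1` _ = set0)//; apply/seteqP; split => // x /= /eqP; rewrite (negbTE yz).
Qed.

Lemma simple_fun_if A (s1 s2 : T -> E) : measurable A ->
  simple_fun s1 -> simple_fun s2 ->
  simple_fun (fun x => if x \in A then s1 x else s2 x).
Proof.
move=> mA [f1 m1] [f2 m2]; split.
  apply: (@sub_finite_set _ _ (range s1 `|` range s2)); last first.
    by rewrite finite_setU.
  by move=> _ [x _ <-]; case: ifP => _; [left|right]; exists x.
move=> y.
have -> : (fun x => if x \in A then s1 x else s2 x) @^-1` [set y] =
  (A `&` s1 @^-1` [set y]) `|` (~` A `&` s2 @^-1` [set y]).
  apply/seteqP; split => x /=.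
    case: ifPn => [/set_mem|/negP]; first by left.
    by rewrite in_setE; right.
  by move=> [[Ax <-]|[nAx <-]]; [rewrite mem_set|rewrite memNset].
by apply: measurableU; apply: measurableI => //; exact: measurableC.
Qed.

Lemma simple_funB s t : simple_fun s -> simple_fun t ->
  simple_fun (fun x => s x - t x).
Proof.
move=> ss st; split.
  by apply: (finite_image11 (fun y z => y - z)); [case: ss|case: st].
move=> y; have -> : (fun x => s x - t x) @^-1` [set y] =
    \bigcup_(z in range s) (s @^-1` [set z] `&` t @^-1` [set z - y]).
  apply/seteqP; split => [x /= <-|x [_ [x' _ <-] [/= -> ->]]].
    by exists (s x); [exists x|split => //=; rewrite subKr].
  by rewrite /= subKr.
apply: fin_bigcup_measurable; first by case: ss.
by move=> z _; apply: measurableI; exact: simple_fun_preimage.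
Qed.

End measurability_of_simple_functions.

Section pettis.
Context {R : realType} {d : measure_display} {T : measurableType d}.
Variable mu : {measure set T -> \bar R}.
Hypothesis cmu : measure_is_complete mu.
Context {E : normedModType R[i]}.
Implicit Types (D : set T) (F : T -> E).

Definition essentially_separable_on D F (e : nat -> E) :=
  {ae mu, forall x, D x -> forall eps : R, 0 < eps ->
    exists j, normr_of (F x - e j) < eps}.

Lemma strongly_measurable_normB D F y : measurable D ->
  strongly_measurable mu D F ->
  measurable_fun D (fun x => normr_of (F x - y)).
Proof.
move=> mD [s [ss sF]].
apply: (@ae_measurable_fun_cvg _ _ _ mu _ (fun n x => normr_of (s n x - y))) => //.
  move=> n; apply: (@measurable_fun_simple _ _ _ _ (s n) _ (fun z _ => normr_of (z - y))) => //.
apply: filterS sF => x sx /sx h.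
by apply: normr_of_cvg; apply: cvgB => //; exact: cvg_cst.
Qed.

Lemma strongly_measurable_norm D F : measurable D ->
  strongly_measurable mu D F -> measurable_fun D (fun x => normr_of (F x)).
Proof.
move=> mD /(strongly_measurable_normB 0 mD).
by under eq_fun do rewrite subr0.
Qed.

Lemma measurable_norm_lt D F y (c : R) : measurable D ->
  strongly_measurable mu D F ->
  measurable (D `&` [set x | normr_of (F x - y) < c]).
Proof.
move=> mD /(strongly_measurable_normB y mD) mF.
have mb : measurable_fun D (fun x => normr_of (F x - y) < c).
  exact: measurable_fun_ltr.
by have := mb mD [set true] I.
Qed.

Lemma measurable_norm_gt D F y (c : R) : measurable D ->
  strongly_measurable mu D F ->
  measurable (D `&` [set x | c < normr_of (F x - y)]).
Proof.
move=> mD /(strongly_measurable_normB y mD) mF.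
have mb : measurable_fun D (fun x => c < normr_of (F x - y)).
  exact: measurable_fun_ltr.
by have := mb mD [set true] I.
Qed.

Lemma strongly_measurableB D F (G : T -> E) :
  strongly_measurable mu D F -> strongly_measurable mu D G ->
  strongly_measurable mu D (fun x => F x - G x).
Proof.
move=> [s [ss sF]] [t [st tG]]; exists (fun n x => s n x - t n x); split.
  by move=> n; exact: simple_funB.
by apply: filterS2 sF tG => x sx tx Dx; apply: cvgB; [exact: sx|exact: tx].
Qed.

Lemma strongly_measurable_separable D F : strongly_measurable mu D F ->
  exists e, essentially_separable_on D F e.
Proof.
move=> [s [ss sF]].
have /choice[r rE] n : exists r : seq E, range (s n) = [set` r].
  by have [/finite_seqP] := ss n.
exists (fun m => if @unpickle (nat * nat)%type m is Some (n, i) then nth 0 (r n) i else 0).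
apply: filterS sF => x sx /sx /normr_of_cvgP h eps /h [n _ /(_ n (leqnn n)) /= he].
have : [set` r n] (s n x) by rewrite -rE; exists x.
move=> /= sr; exists (pickle (n, index (s n x) (r n))).
by rewrite pickleK nth_index.
Qed.

(** The approximating simple function s n sends x to the nearest of the points
    e 0, ..., e n to F x, the first one in case of a tie; its level sets are
    given by inequalities between the measurable functions |F x - e j|. *)
Lemma pettis D F (e : nat -> E) : measurable D ->
  (forall y, measurable_fun D (fun x => normr_of (F x - y))) ->
  essentially_separable_on D F e ->
  strongly_measurable mu D F.
Proof.
move=> mD mF eF.
pose closer n (s : T -> E) := [set x | D x /\
  normr_of (F x - e n.+1) < normr_of (F x - s x)].
pose s := fix s n := if n is m.+1 then
    fun x => if x \in closer m (s m) then e m.+1 else s m x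
  else fun=> e 0%N.
have simple_s n : simple_fun (s n).
  elim: n => [|n IHn]; first exact: simple_fun_cst.
  apply: simple_fun_if => //; last exact: simple_fun_cst.
  have mb : measurable_fun D (fun x => normr_of (F x - e n.+1) < normr_of (F x - s n x)).
    apply: measurable_fun_ltr => //.
    exact: (@measurable_fun_simple _ _ _ _ (s n) _ (fun z x => normr_of (F x - z))).
  by have := mb mD [set true] I.
have best n j x : D x -> (j <= n)%N -> normr_of (F x - s n x) <= normr_of (F x - e j).
  move=> Dx; elim: n => [|n IHn]; first by rewrite leqn0 => /eqP ->.
  rewrite leq_eqVlt => /predU1P[->|]; last rewrite ltnS => /IHn jn.
    rewrite /=; case: ifPn => [//|/negP]; rewrite in_setE /closer /= => h.
    by rewrite leNgt; apply/negP => ?; apply: h.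
  rewrite /=; case: ifPn => [|//]; rewrite in_setE => -[_ /ltW h].
  exact: le_trans jn.
exists s; split => //.
apply: filterS eF => x h Dx; apply/normr_of_cvgP => eps /(h Dx)[j je].
exists j => // n /= jn; exact: le_lt_trans (best _ _ _ Dx jn) je.
Qed.

End pettis.

(** * The Bochner integral *)

Lemma cvge0_lt {R : realType} {T : Type} {F : set_system T} {FF : Filter F}
    (u : T -> \bar R) (e : R) : u x @[x --> F] --> 0%E -> 0 < e ->
  \forall x \near F, (u x < e%:E)%E.
Proof.
move=> u0 e0; apply: (u0 [set y | (y < e%:E)%E]).
by apply: open_nbhs_nbhs; split; [exact: open_ereal_lt_ereal|rewrite /= lte_fin].
Qed.

Section bochner_theory.
Context {R : realType} {d : measure_display} {T : measurableType d}.
Variable mu : {measure set T -> \bar R}.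
Hypothesis cmu : measure_is_complete mu.
Context {E : normedModType R[i]}.
Implicit Types (D : set T) (F G s t : T -> E).

Let simple_range s : simple_fun s ->
  exists2 r : seq E, uniq r & range s `<=` [set` r].
Proof.
move=> [/finite_seqP[r rE] _]; exists (undup r); first exact: undup_uniq.
by move=> y; rewrite rE /= mem_undup.
Qed.

Let simple_integralE D s (r : seq E) : uniq r -> range s `<=` [set` r] ->
  simple_integral mu D s =
    \sum_(y <- r) (fine (mu (D `&` s @^-1` [set y])))%:C *: y.
Proof.
move=> ur sr; rewrite /simple_integral (fsbig_fwiden r)// => y [_ nsy] /=.
rewrite (_ : s @^-1` [set y] = set0) ?setI0 ?measure0 ?scale0r//.
by apply/seteqP; split => // x /= xy; apply: nsy; exists x.
Qed.

(** Where fine has its junk value at +oo, it is multiplied by y = 0. *)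
Let level_split D s t (r : seq E) y : measurable D ->
  integrable_simple_fun mu D s -> simple_fun t ->
  uniq r -> range t `<=` [set` r] ->
  (fine (mu (D `&` s @^-1` [set y])))%:C *: y =
  \sum_(z <- r) (fine (mu (D `&` s @^-1` [set y] `&` t @^-1` [set z])))%:C *: y.
Proof.
move=> mD [ss sfin] st ur tr.
have [->|y0] := eqVneq y 0.
  by rewrite scaler0 big1// => z _; rewrite scaler0.
have ms : measurable (D `&` s @^-1` [set y]).
  by apply: measurableI => //; exact: simple_fun_preimage.
have mt z : measurable (D `&` s @^-1` [set y] `&` t @^-1` [set z]).
  by apply: measurableI => //; exact: simple_fun_preimage.
rewrite -scaler_suml; congr (_ *: y).
rewrite -raddf_sum; congr (_ %:C).
rewrite sum_fine; last first.
  move=> z _; rewrite ge0_fin_numE//; apply: le_lt_trans (sfin y y0).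
  by apply: le_measure; rewrite ?inE//; exact: subIsetl.
congr fine; rewrite (fsbig_seq _ _ ur) -measure_fin_bigcup//.
  congr (mu _); apply/seteqP; split => [x Dx|x [z _ [Dx _]]//].
  by exists (t x) => //; apply: tr; exists x.
by move=> z1 z2 _ _ [x [[_ /= <-] [_ /= <-]]].
Qed.

Lemma measurable_normB_simple D s t : simple_fun s -> simple_fun t ->
  measurable_fun D (fun x => normr_of (s x - t x)).
Proof.
move=> ss st.
apply: (measurable_fun_simple (psi := fun y x => normr_of (y - t x))) => // y.
exact: (measurable_fun_simple (psi := fun z x => normr_of (y - z))).
Qed.

(** Both integrals are sums over the common refinement J of the level sets of s
    and t, on whose pieces P i the difference s - t is constant. *)
Lemma simple_integralB_le D s t : measurable D ->
  integrable_simple_fun mu D s -> integrable_simple_fun mu D t ->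
  ((normr_of (simple_integral mu D s - simple_integral mu D t))%:E <=
   \int[mu]_(x in D) (normr_of (s x - t x))%:E)%E.
Proof.
move=> mD is_ it_; have [ss sfin] := is_; have [st tfin] := it_.
have [r ur sr] := simple_range ss; have [r' ur' tr] := simple_range st.
pose J := [seq (y, z) | y <- r, z <- r'].
pose P (i : E * E) := D `&` s @^-1` [set i.1] `&` t @^-1` [set i.2].
have uJ : uniq J by apply: allpairs_uniq => // -[? ?] [? ?] _ _ [-> ->].
have mP i : measurable (P i).
  apply: measurableI; last exact: simple_fun_preimage.
  by apply: measurableI => //; exact: simple_fun_preimage.
have Pfin i : ((normr_of (i.1 - i.2))%:E * mu (P i) =
    (normr_of (i.1 - i.2) * fine (mu (P i)))%:E)%E.
  have [i12|i12] := eqVneq i.1 i.2.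
    by rewrite i12 subrr normr_of0 mul0r mul0e.
  rewrite EFinM fineK// ge0_fin_numE//.
  have [i10|i10] := eqVneq i.1 0.
    apply: le_lt_trans (tfin i.2 _); last by rewrite -i10 eq_sym.
    apply: le_measure; rewrite ?inE//; last by apply: setSI; exact: subIsetl.
    by apply: measurableI => //; exact: simple_fun_preimage.
  apply: le_lt_trans (sfin i.1 i10).
  apply: le_measure; rewrite ?inE//; last exact: subIsetl.
  by apply: measurableI => //; exact: simple_fun_preimage.
have -> : simple_integral mu D s - simple_integral mu D t =
    \sum_(i <- J) (fine (mu (P i)))%:C *: (i.1 - i.2).
  under eq_bigr do rewrite scalerBr.
  rewrite big_split/= sumrN; congr (_ - _).
    rewrite (simple_integralE _ ur sr) big_allpairs; apply: eq_bigr => y _.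
    exact: level_split.
  rewrite (simple_integralE _ ur' tr) big_allpairs exchange_big/=.
  apply: eq_bigr => z _; rewrite (level_split z mD it_ ss ur sr).
  by apply: eq_bigr => y _; rewrite /P setIAC.
have -> : (\int[mu]_(x in D) (normr_of (s x - t x))%:E =
    \sum_(i <- J) (normr_of (i.1 - i.2))%:E * mu (P i))%E.
  have -> : D = \big[setU/set0]_(i <- J) P i.
    rewrite -bigcup_seq; apply/seteqP; split => [x Dx|x [i _ [[]]]//].
    exists (s x, t x) => //=; apply/allpairsP; exists (s x, t x).
    by split => //; [apply: sr; exists x|apply: tr; exists x].
  rewrite ge0_integral_bigsetU//.
  - apply: eq_bigr => i _; rewrite -integral_cst//.
    by apply: eq_integral => x; rewrite inE => -[[_ /= ->] /= ->].
  - move=> [a b] [a' b'] _ _ [x [[[_ /= <-] /= <-] [[_ /= <-] /= <-]]] //.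
  - by apply/measurable_EFinP; exact: measurable_normB_simple.
  - by move=> x _; rewrite lee_fin normr_of_ge0.
rewrite (eq_bigr _ (fun i _ => Pfin i)).
rewrite sumEFin lee_fin.
have sumle (J' : seq (E * E)) :
    normr_of (\sum_(i <- J') (fine (mu (P i)))%:C *: (i.1 - i.2)) <=
    \sum_(i <- J') normr_of (i.1 - i.2) * fine (mu (P i)).
  elim: J' => [|i J' IH]; first by rewrite !big_nil normr_of0.
  rewrite !big_cons; apply: (le_trans (normr_ofD _ _)); apply: lerD => //.
  by rewrite normr_ofZ ger0_norm ?fine_ge0// mulrC.
exact: sumle.
Qed.

Lemma strongly_measurable_subr D F G : measurable D ->
  strongly_measurable mu D F -> strongly_measurable mu D G ->
  measurable_fun D (fun x => normr_of (F x - G x)).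
Proof.
move=> mD mF mG; apply: (strongly_measurable_norm cmu mD).
exact: strongly_measurableB.
Qed.

Lemma integral_norm_tri D F G (H : T -> E) : measurable D ->
  strongly_measurable mu D F -> strongly_measurable mu D G ->
  strongly_measurable mu D H ->
  (\int[mu]_(x in D) (normr_of (F x - H x))%:E <=
   \int[mu]_(x in D) (normr_of (F x - G x))%:E +
   \int[mu]_(x in D) (normr_of (G x - H x))%:E)%E.
Proof.
move=> mD mF mG mH.
rewrite -ge0_integralD//; first apply: ge0_le_integral => //.
all: try by move=> x _; rewrite lee_fin normr_of_ge0.
all: try by apply/measurable_EFinP; exact: strongly_measurable_subr.
- apply: emeasurable_funD; apply/measurable_EFinP; exact: strongly_measurable_subr.
- by move=> x _; rewrite -EFinD lee_fin; exact: normr_of_tri.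
Qed.

Lemma simple_strongly_measurable D s : simple_fun s -> strongly_measurable mu D s.
Proof. by exists (fun=> s); split => //; apply: aeW => x _; exact: cvg_cst. Qed.

(** The inequality for simple functions passes to the limit along
    approximations of F and G. Applied to F = G it shows that the integral does
    not depend on the approximating sequence. *)
Lemma bochner_integral_le_dist D F G (I J : E) : measurable D ->
  is_bochner_integral mu D F I -> is_bochner_integral mu D G J ->
  ((normr_of (I - J))%:E <= \int[mu]_(x in D) (normr_of (F x - G x))%:E)%E.
Proof.
move=> mD [mF [s [is_ sF] sI]] [mG [t [it_ tG] tJ]].
have ms n : strongly_measurable mu D (s n) by apply: simple_strongly_measurable; case: (is_ n).
have mt n : strongly_measurable mu D (t n) by apply: simple_strongly_measurable; case: (it_ n).
set c := (\int[mu]_(x in D) _)%E.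
apply/lee_addgt0Pr => e e0.
have e4 : 0 < e / 4 by rewrite divr_gt0.
near \oo => n.
have h1 : normr_of (I - simple_integral mu D (s n)) <= e / 4.
  by near: n; move/normr_of_cvgP : sI => /(_ _ e4); apply: filterS => n /ltW.
have h2 : normr_of (J - simple_integral mu D (t n)) <= e / 4.
  by near: n; move/normr_of_cvgP : tJ => /(_ _ e4); apply: filterS => n /ltW.
have h3 : (\int[mu]_(x in D) (normr_of (F x - s n x))%:E <= (e / 4)%:E)%E.
  by apply/ltW; near: n; exact: cvge0_lt sF e4.
have h4 : (\int[mu]_(x in D) (normr_of (G x - t n x))%:E <= (e / 4)%:E)%E.
  by apply/ltW; near: n; exact: cvge0_lt tG e4.
have h5 := simple_integralB_le mD (is_ n) (it_ n).
have h6 : ((normr_of (simple_integral mu D (s n) - simple_integral mu D (t n)))%:E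
    <= (e / 4)%:E + (c + (e / 4)%:E))%E.
  apply: (le_trans h5).
  apply: (le_trans (integral_norm_tri mD (ms n) mF (mt n))); apply: leeD.
    by under eq_integral do rewrite normr_ofB.
  by apply: (le_trans (integral_norm_tri mD mF mG (mt n))); rewrite leeD2l.
have : normr_of (I - J) <= e / 4 + e / 4 +
    normr_of (simple_integral mu D (s n) - simple_integral mu D (t n)).
  apply: le_trans (normr_of_tri (simple_integral mu D (s n)) _ _) _.
  rewrite -addrA lerD//.
  apply: le_trans (normr_of_tri (simple_integral mu D (t n)) _ _) _.
  by rewrite addrC lerD// normr_ofB.
rewrite -lee_fin => /le_trans; apply; rewrite EFinD.
apply: (le_trans (leeD2l _ h6)).
rewrite (addeC c (e / 4)%:E) 2!addeA -!EFinD [leLHS]addeC leeD2l// lee_fin; lra.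
Unshelve. all: by end_near. Qed.

End bochner_theory.

Section bochner_existence.
Context {R : realType} {d : measure_display} {T : measurableType d}.
Variable mu : {measure set T -> \bar R}.
Hypothesis cmu : measure_is_complete mu.
Context {E : normedModType R[i]}.
Implicit Types (D : set T) (F G s t : T -> E).

(** Simple functions that converge to F almost everywhere need not converge in
    mean. Replacing s n by 0 where |s n| > 2 |F| keeps the pointwise limit and
    makes |F - s n| at most 3 |F|, so that dominated convergence applies. *)
Lemma integrable_norm_bochner D F : measurable D ->
  strongly_measurable mu D F ->
  (\int[mu]_(x in D) (normr_of (F x))%:E < +oo)%E ->
  bochner_integrable mu D F.
Proof.
move=> mD mF intF; split => //; have [s [ss sF]] := mF.
have mnF := strongly_measurable_norm cmu mD mF.
pose A n := D `&` [set x | normr_of (s n x) <= 2 * normr_of (F x)].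
have mA n : measurable (A n).
  have : measurable_fun D (fun x => normr_of (s n x) <= 2 * normr_of (F x)).
    apply: measurable_fun_ler.
      apply: (measurable_fun_simple (psi := fun y _ => normr_of y)) => // y.
    by apply: measurable_funM.
  by move=> /(_ mD [set true] I).
pose s' n x := if x \in A n then s n x else 0.
have ss' n : simple_fun (s' n).
  by apply: simple_fun_if => //; exact: simple_fun_cst.
have s'le n x : D x -> normr_of (s' n x) <= 2 * normr_of (F x).
  move=> Dx; rewrite /s'; case: ifPn => [|_]; first by rewrite in_setE => -[].
  by rewrite normr_of0 mulr_ge0// normr_of_ge0.
have dist_le n x : D x -> normr_of (F x - s' n x) <= 3 * normr_of (F x).
  move=> Dx; apply: le_trans (normr_ofD _ _) _; rewrite normr_ofN.
  by have := s'le n x Dx; lra.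
have s'F : {ae mu, forall x, D x -> s' n x @[n --> \oo] --> F x}.
  apply: filterS sF => x sx Dx; have {sx} := sx Dx.
  have [Fx0 _|Fx0 /normr_of_cvgP sx] := eqVneq (F x) 0.
    rewrite Fx0; apply: cvg_near_cst; apply: nearW => n.
    apply: normr_of_eq0; apply/eqP; rewrite eq_le normr_of_ge0 andbT.
    by have := s'le n x Dx; rewrite Fx0 normr_of0 mulr0.
  have Fx_gt0 : 0 < normr_of (F x).
    exact: normr_of_gt0.
  apply/normr_of_cvgP => e e0.
  have := sx _ e0; have := sx _ Fx_gt0; apply: filterS2 => n h1 h2.
  rewrite /s' mem_set//; split => //=.
  have := normr_ofD (F x) (s n x - F x); rewrite addrC subrK.
  by rewrite (normr_ofB (s n x)); lra.
exists s'; split.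
  move=> n; split => // y y0.
  have ny0 : 0 < normr_of y.
    exact: normr_of_gt0.
  set B := D `&` _.
  have mB : measurable B by apply: measurableI => //; exact: simple_fun_preimage.
  have : ((normr_of y / 2)%:E * mu B < +oo)%E.
    apply: le_lt_trans intF; rewrite -integral_cst//.
    apply: (@le_trans _ _ (\int[mu]_(x in B) (normr_of (F x))%:E)%E).
      apply: ge0_le_integral => //.
      - by move=> x _; rewrite lee_fin divr_ge0// ltW.
      - apply/measurable_EFinP; apply: measurable_funS mnF => //; exact: subIsetl.
      - move=> x [Dx /= sxy]; rewrite lee_fin.
        by have := s'le n x Dx; rewrite sxy; lra.
    apply: ge0_subset_integral => //.
    - exact/measurable_EFinP.
    - by move=> x _; rewrite lee_fin normr_of_ge0.
    - exact: subIsetl.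
  move=> h; rewrite ltNge leye_eq; apply/negP => /eqP muB.
  by move: h; rewrite muB gt0_muley ?ltxx// lte_fin divr_gt0.
have mdist n : measurable_fun D (fun x => normr_of (F x - s' n x)).
  apply: (strongly_measurable_subr cmu mD mF); exact: simple_strongly_measurable.
have := @dominated_convergence _ _ _ mu D mD
  (fun n x => (normr_of (F x - s' n x))%:E) (cst 0%E)
  (fun x => (3 * normr_of (F x))%:E).
case.
- by move=> n; exact/measurable_EFinP.
- exact: measurable_cst.
- apply: filterS s'F => x sx /sx sF'; apply: cvg_EFin; first exact: nearW.
  rewrite -(@normr_of0 _ E) -(subrr (F x)).
  by apply: normr_of_cvg; apply: cvgB => //; exact: cvg_cst.
- apply/integrableP; split.
    by apply/measurable_EFinP; apply: measurable_funM.
  under eq_integral.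
    move=> x _; rewrite gee0_abs ?lee_fin ?mulr_ge0 ?normr_of_ge0// EFinM.
    over.
  rewrite ge0_integralZl//.
  - by rewrite lte_mul_pinfty// lee_fin.
  - exact/measurable_EFinP.
  - by move=> x _; rewrite lee_fin normr_of_ge0.
- apply: aeW => x n Dx; rewrite gee0_abs ?lee_fin ?normr_of_ge0//.
  exact: dist_le.
by move=> _ _; rewrite integral0.
Qed.

End bochner_existence.

Section bochner_integral_value.
Context {R : realType} {d : measure_display} {T : measurableType d}.
Variable mu : {measure set T -> \bar R}.
Hypothesis cmu : measure_is_complete mu.
Context {E : completeNormedModType R[i]}.
Implicit Types (D : set T) (F G s t : T -> E).

(** The integrals of approximating simple functions form a Cauchy sequence, by
    the inequality for simple functions, so that E contains their limit. *)
Lemma bochner_integralP D F : measurable D -> bochner_integrable mu D F ->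
  is_bochner_integral mu D F (bochner_integral mu D F).
Proof.
move=> mD [mF [s sF]]; apply: getPex.
have [is_ sF0] := sF.
have ss n : strongly_measurable mu D (s n).
  by apply: simple_strongly_measurable; case: (is_ n).
suff /cvg_ex[I sI] : cvg (simple_integral mu D (s n) @[n --> \oo]).
  by exists I; split => //; exists s.
apply/cauchy_cvgP; apply: cauchy_exP => -[e1 e2]; rewrite ltcE/= => /andP[/eqP-> e0].
have e2' : 0 < e1 / 2 by rewrite divr_gt0.
have [N _ sN] := cvge0_lt sF0 e2'.
exists (simple_integral mu D (s N)); exists N => // n /= Nn.
rewrite -ball_normE /ball_/= normr_ofE ltcR -lte_fin.
apply: (le_lt_trans (simple_integralB_le mD (is_ N) (is_ n))).
apply: (le_lt_trans (integral_norm_tri cmu mD (ss N) mF (ss n))).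
rewrite [X in (_ < X%:E)%E](splitr e1) EFinD; apply: lteD; last exact: (sN n Nn).
under eq_integral do rewrite normr_ofB.
exact: (sN N (leqnn N)).
Qed.

Lemma bochner_integralB_le D F G : measurable D ->
  bochner_integrable mu D F -> bochner_integrable mu D G ->
  ((normr_of (bochner_integral mu D F - bochner_integral mu D G))%:E <=
   \int[mu]_(x in D) (normr_of (F x - G x))%:E)%E.
Proof.
by move=> mD iF iG; apply: bochner_integral_le_dist => //; exact: bochner_integralP.
Qed.

Lemma bochner_integral_unique D F I : measurable D ->
  is_bochner_integral mu D F I -> bochner_integral mu D F = I.
Proof.
move=> mD FI; have iF : bochner_integrable mu D F.
  by case: FI => mF [s sF _]; split => //; exists s.
have := bochner_integral_le_dist cmu mD (bochner_integralP mD iF) FI.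
under eq_integral do rewrite subrr normr_of0.
rewrite integral0 lee_fin => h; apply/eqP; rewrite -subr_eq0; apply/eqP.
by apply: normr_of_eq0; apply/eqP; rewrite eq_le h normr_of_ge0.
Qed.

End bochner_integral_value.

(** * Change of variables *)

Section change_of_variables.
Context {R : realType}.
Implicit Types (D : set (lebesgueR R)) (c x : R).

Lemma measurable_fun_shift (d : measure_display) (U : sigmaRingType d)
    (phi : lebesgueR R -> U) D c : measurable D -> measurable_fun D phi ->
  measurable_fun ([set x : R | D (x + c)] : set (lebesgueR R))
                 ((fun x : R => phi (x + c)) : lebesgueR R -> U).
Proof. by move=> mD mphi _ B mB; exact: (leb_measurable_shift c (mphi mD B mB)). Qed.

Lemma ge0_integral_shift (phi : lebesgueR R -> \bar R) D c : measurable D ->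
  measurable_fun D phi -> (forall x, D x -> 0 <= phi x)%E ->
  (\int[leb]_(x in D) phi x = \int[leb]_(x in [set x : R | D (x + c)%R]) phi (x + c)%R)%E.
Proof.
move=> mD mphi phi0.
pose sh : lebesgueR R -> lebesgueR R := fun x : R => x + c.
have msh : measurable_fun setT sh.
  by move=> _ B mB; rewrite setTI; exact: leb_measurable_shift.
have := @ge0_integral_pushforward _ _ _ _ R sh msh leb D phi mD mphi.
rewrite /comp /sh => <-; last by move=> x; rewrite inE; exact: phi0.
apply: eq_measure_integral => A mA _; exact/esym/leb_shift.
Qed.

Lemma ge0_integral_reflect (phi : lebesgueR R -> \bar R) D c : measurable D ->
  measurable_fun D phi -> (forall x, D x -> 0 <= phi x)%E ->
  (\int[leb]_(x in D) phi x = \int[leb]_(x in [set x : R | D (c - x)%R]) phi (c - x)%R)%E.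
Proof.
move=> mD mphi phi0.
pose sh : lebesgueR R -> lebesgueR R := fun x : R => c - x.
have msh : measurable_fun setT sh.
  by move=> _ B mB; rewrite setTI; exact: leb_measurable_reflect.
have := @ge0_integral_pushforward _ _ _ _ R sh msh leb D phi mD mphi.
rewrite /comp /sh => <-; last by move=> x; rewrite inE; exact: phi0.
apply: eq_measure_integral => A mA _; exact/esym/leb_reflect.
Qed.

Lemma ae_reflect (P : R -> Prop) c :
  {ae leb, forall x : R, P x} -> {ae leb, forall x : R, P (c - x)}.
Proof.
move=> [N [mN N0 sN]]; exists [set x : R | N (c - x)]; split.
- exact: leb_measurable_reflect.
- by rewrite -N0; exact: leb_reflect.
- by move=> x nP; apply: sN.
Qed.

Lemma continuous_leb_measurable (D : set R) (phi : R -> R) : open D ->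
  (forall x, D x -> {for x, continuous phi}) ->
  measurable_fun (D : set (lebesgueR R)) (phi : lebesgueR R -> R).
Proof.
move=> oD cphi _ B mB; apply: borel_leb_measurable.
apply: open_continuous_measurable_fun => //; last exact: open_measurable.
by move=> x; rewrite inE => /cphi.
Qed.

Context {E : normedModType R[i]}.
Implicit Types (F : R -> E).

Lemma simple_fun_reflect (s : lebesgueR R -> E) c : simple_fun s ->
  simple_fun ((fun x : R => s (c - x)) : lebesgueR R -> E).
Proof.
move=> [fs ms]; split.
  by apply: sub_finite_set fs => _ [x _ <-]; exists (c - x).
by move=> y; exact: (leb_measurable_reflect c (ms y)).
Qed.

Lemma strongly_measurable_reflect (D : set R) F c :
  strongly_measurable (T := lebesgueR R) leb D F ->
  strongly_measurable (T := lebesgueR R) leb [set x : R | D (c - x)]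
    (fun x : R => F (c - x)).
Proof.
move=> [s [ss sF]]; exists (fun n (x : R) => s n (c - x)); split.
  by move=> n; exact: simple_fun_reflect.
exact: (ae_reflect c sF).
Qed.

Lemma strongly_measurable_shift (D : set R) F c :
  strongly_measurable (T := lebesgueR R) leb D F ->
  strongly_measurable (T := lebesgueR R) leb [set x : R | D (x + c)]
    (fun x : R => F (x + c)).
Proof.
move=> /(strongly_measurable_reflect c)/(strongly_measurable_reflect 0).
congr (strongly_measurable _ _ _).
  by apply/seteqP; split => x /=; rewrite sub0r opprK addrC.
by apply/funext => x; rewrite sub0r opprK addrC.
Qed.

Lemma strongly_measurable_subset (D D' : set R) F : D' `<=` D ->
  strongly_measurable (T := lebesgueR R) leb D F ->
  strongly_measurable (T := lebesgueR R) leb D' F.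
Proof.
move=> D'D [s [ss sF]]; exists s; split => //.
by apply: filterS sF => x sx /D'D/sx.
Qed.

Lemma is_bochner_integral_reflect (D : set R) F c (I : E) :
  measurable (D : set (lebesgueR R)) ->
  is_bochner_integral (T := lebesgueR R) leb D F I ->
  is_bochner_integral (T := lebesgueR R) leb [set x : R | D (c - x)]
    (fun x : R => F (c - x)) I.
Proof.
move=> mD [mF [s [is_ sF] sI]]; split; first exact: strongly_measurable_reflect.
have levelE n y : leb ([set x : R | D (c - x)] `&`
      (fun x : R => s n (c - x)) @^-1` [set y]) =
    leb (D `&` s n @^-1` [set y]).
  exact: (leb_reflect c (D `&` s n @^-1` [set y])).
exists (fun n (x : R) => s n (c - x)); first split.
- move=> n; split => [|y y0]; first by apply: simple_fun_reflect; case: (is_ n).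
  by rewrite levelE; case: (is_ n) => _; exact.
- apply: cvg_trans sF; apply: near_eq_cvg; apply: nearW => n /=.
  rewrite (ge0_integral_reflect c)//.
  + apply/measurable_EFinP; apply: (strongly_measurable_subr leb_complete) => //.
    by apply: simple_strongly_measurable; case: (is_ n).
  + by move=> x _; rewrite lee_fin normr_of_ge0.
apply: cvg_trans sI; apply: near_eq_cvg; apply: nearW => n /=; apply/esym.
rewrite /simple_integral.
have -> : range (fun x : R => s n (c - x)) = range (s n).
  apply/seteqP; split => _ [x _ <-]; first by exists (c - x).
  by exists (c - x) => //; rewrite subKr.
by apply: eq_fsbigr => y _; rewrite levelE.
Qed.

End change_of_variables.

(** * Strongly continuous families of operators *)

Section operator_norm.
Context {R : realType} {X Y : normedModType R[i]}.
Implicit Types A : {linear X -> Y}.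

(** Makes the set whose supremum is the operator norm bounded above, so that
    opnorm is not the default value of sup. *)
Lemma linear_continuous_bounded A : continuous A ->
  exists2 M : R, 0 < M & forall x, normr_of (A x) <= M * normr_of x.
Proof.
move=> cA; have /normr_of_cvgP := cA 0.
rewrite linear0 => /(_ _ ltr01)/nbhs_norm0P[[e1 e2] + h].
rewrite /= ltcE/= => /andP[/eqP e20 e0]; rewrite {}e20 in h.
have {}h y : normr_of y < e1 -> normr_of (A y) < 1.
  move=> ye; rewrite -normr_ofN -sub0r; apply: h.
  by rewrite /= normr_ofE ltcR.
exists (2 / e1); first by rewrite divr_gt0.
move=> x; have [->|x0] := eqVneq x 0; first by rewrite linear0 !normr_of0 mulr0.
have nx0 : 0 < normr_of x.
  exact: normr_of_gt0.
have := h ((e1 / 2 / normr_of x)%:C *: x).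
rewrite linearZZ !normr_ofZ.
rewrite ger0_norm; last by rewrite !divr_ge0 ?normr_of_ge0// ltW.
rewrite divfK ?gt_eqF// => /(_ _)/ltW; rewrite ltr_pdivrMr// ltr_pMr// ltr1n => /(_ isT).
by rewrite mulrAC ler_pdivrMr// mul1r -ler_pdivlMl ?divr_gt0// invf_div.
Qed.

Lemma opnorm_ge A x : continuous A -> normr_of x <= 1 -> normr_of (A x) <= opnorm A.
Proof.
move=> /linear_continuous_bounded[M M0 AM] x1.
apply: ub_le_sup; last by exists x.
exists M => _ [y y1 <-]; apply: (le_trans (AM y)).
by rewrite ler_piMr// ltW.
Qed.

Lemma opnorm_ge0 A : 0 <= opnorm A.
Proof.
rewrite /opnorm; set S := (X in sup X).
have [[_ ubS]|nS] := pselect (has_sup S); last by rewrite sup_out.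
by apply: ub_le_sup => //; exists 0; rewrite /= ?linear0 ?normr_of0.
Qed.

Lemma opnormP A x : continuous A -> normr_of (A x) <= opnorm A * normr_of x.
Proof.
move=> cA; have [->|x0] := eqVneq x 0; first by rewrite linear0 !normr_of0 mulr0.
have nx0 : 0 < normr_of x.
  exact: normr_of_gt0.
have := @opnorm_ge A ((normr_of x)^-1%:C *: x) cA.
rewrite linearZZ !normr_ofZ ger0_norm ?invr_ge0 ?normr_of_ge0//.
by rewrite mulVf ?gt_eqF// lexx => /(_ isT); rewrite ler_pdivrMl// mulrC.
Qed.

Lemma opnorm_gtP A c : (exists2 x, normr_of x <= 1 & c < normr_of (A x)) ->
  continuous A -> c < opnorm A.
Proof. by move=> [x x1 cx] cA; exact: lt_le_trans cx (opnorm_ge cA x1). Qed.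

Lemma lt_opnormP A c : c < opnorm A ->
  exists2 x, normr_of x <= 1 & c < normr_of (A x).
Proof.
move=> cA; suff /sup_gt/(_ cA)[_ [x x1 <-] cx] :
    [set normr_of (A x) | x in [set x : X | normr_of x <= 1]] !=set0 by exists x.
by exists (normr_of (A 0)); exists 0 => //=; rewrite normr_of0.
Qed.

End operator_norm.

Section operator_family.
Context {R : realType} {X Y : normedModType R[i]}.
Variable Rf : R -> {linear X -> Y}.
Hypothesis Rf_bounded : forall t : R, 0 < t -> continuous (Rf t).
Hypothesis Rf_continuous : forall (x : X) (t : R), 0 < t ->
  {for t, continuous (fun s : R => Rf s x)}.

Local Notation pos := (`]0, +oo[%classic : set (lebesgueR R)).

Let open_pos : open (`]0, +oo[%classic : set R). Proof. exact: interval_open. Qed.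

Lemma measurable_orbit x y :
  measurable_fun pos (fun t : R => normr_of (Rf t x - y)).
Proof.
apply: continuous_leb_measurable => // t; rewrite /= in_itv/= andbT => t0.
by apply: normr_of_cvg; apply: cvgB; [exact: Rf_continuous|exact: cvg_cst].
Qed.

(** On t > 0 the operator norm is a supremum of the continuous functions
    |R(t) x| with |x| <= 1, hence lower semicontinuous. *)
Lemma measurable_opnorm : measurable_fun pos (fun t : R => opnorm (Rf t)).
Proof.
apply: (measurability _ (RGenOInfty.measurableE R)) => //.
move=> _ [_ [c ->] <-].
apply: leb_measurable_open.
have -> : (`]0, +oo[ `&` (fun t : R => opnorm (Rf t)) @^-1` `]c, +oo[)%classic =
    \bigcup_(x in [set x | normr_of x <= 1])
      (`]0, +oo[ `&` (fun t : R => normr_of (Rf t x)) @^-1` `]c, +oo[)%classic.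
  apply/seteqP; split => [t [t0]|t [x x1 [t0]]].
    rewrite /= in_itv/= andbT => /lt_opnormP[x x1 cx].
    by exists x => //; split => //; rewrite /= ?in_itv/= ?andbT.
  move: t0; rewrite /= !in_itv/= !andbT => t0 cx; split => //.
  by apply: opnorm_gtP; [exists x|exact: Rf_bounded].
apply: bigcup_open => x _.
apply: (continuous_inP _ open_pos).1; last exact: interval_open.
move=> t; rewrite inE/= in_itv/= andbT => t0.
by apply: normr_of_cvg; exact: Rf_continuous.
Qed.

(** If the e j are essentially dense in the values of v, then the R(r) (e j)
    with r rational are essentially dense in the values of R(t) (v t): first
    e j is chosen close to v t, which uses boundedness of R(t), then r close to
    t, which uses strong continuity at the fixed vector e j. *)
Lemma strongly_measurable_apply (v : R -> X) :
  strongly_measurable (T := lebesgueR R) leb pos v ->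
  strongly_measurable (T := lebesgueR R) leb pos (fun t => Rf t (v t)).
Proof.
move=> mv; have [e eP] := strongly_measurable_separable mv.
have mpos : measurable pos by exact: leb_measurable_itv.
pose e' m := if @unpickle (rat * nat)%type m is Some (r, j) then Rf (ratr r) (e j) else 0.
apply: (@pettis _ _ _ leb _ pos (fun t : R => Rf t (v t)) e' mpos); first move=> y.
  have [s [ss sv]] := mv.
  apply: (@ae_measurable_fun_cvg _ _ _ leb pos
    (fun n (t : R) => normr_of (Rf t (s n t) - y)) _ leb_complete mpos).
  - move=> n; exact: (@measurable_fun_simple _ _ (lebesgueR R) _ (s n) pos
      (fun z (t : R) => normr_of (Rf t z - y)) (ss n)
      (fun z => measurable_orbit z y)).
  - apply: filterS sv => t st t0; apply: normr_of_cvg.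
    apply: cvgB; last exact: cvg_cst.
    apply: (cvg_comp (s^~ t) (Rf t) (st t0)).
    by apply: Rf_bounded; move: t0; rewrite /= in_itv/= andbT.
apply: filterS eP => t et t0 eps eps0.
have t_gt0 : 0 < t by move: t0; rewrite /= in_itv/= andbT.
have [j je] : exists j, normr_of (v t - e j) < eps / 2 / (opnorm (Rf t) + 1).
  by apply: et => //; rewrite !divr_gt0// ltr_wpDl// opnorm_ge0.
have := @Rf_continuous (e j) t t_gt0; move/normr_of_cvgP => /(_ (eps / 2)).
rewrite divr_gt0// => /(_ isT)/nbhs_ballP[del /= del0 hdel].
have ttd : t < t + del by rewrite ltrDl.
have [r] := rat_in_itvoo ttd.
rewrite in_itv/= => /andP[tr rd].
exists (pickle (r, j)); rewrite /e' pickleK.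
apply: (le_lt_trans (normr_of_tri (Rf t (e j)) _ _)).
rewrite (splitr eps); apply: ltr_leD; last first.
  apply/ltW/hdel; rewrite -ball_normE/= ltr_distlC; apply/andP; split; lra.
rewrite -linearB; apply: (le_lt_trans (opnormP _ (Rf_bounded t_gt0))).
have o0 : 0 < opnorm (Rf t) + 1 by rewrite ltr_wpDl// opnorm_ge0.
move: je; rewrite ltr_pdivlMr// => /(le_lt_trans _); apply.
by rewrite mulrC ler_wpM2l ?normr_of_ge0// lerDl.
Qed.

End operator_family.

(** * Young and Hoelder inequalities with variable exponents *)

Section variable_exponent_theory.
Context {R : realType}.
Local Open Scope ereal_scope.

Lemma phi_ge0 (P : \bar R) (t : R) : 0 <= phi P t.
Proof. by case: P => [r||]//=; [rewrite lee_fin powR_ge0|case: ifP]. Qed.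

(** Dropping the factors 1/p and 1/q of Young's inequality makes the case
    q = +oo, where p = 1, uniform with the others; the price is a constant 2 in
    the Hoelder inequality. *)
Lemma young_phi (p t s : R) (q : \bar R) : (1 <= p)%R -> 1 <= q ->
  (p^-1)%:E + q^-1 = 1 -> (0 <= t)%R -> (0 <= s)%R ->
  (t * s)%:E <= phi q t + phi p%:E s.
Proof.
move=> p1 q1 pq t0 s0; have p0 : (0 < p)%R by exact: lt_le_trans p1.
case: q q1 pq => [q||//] q1 pq.
  have q0 : (0 < q)%R by apply: (lt_le_trans ltr01); rewrite -lee_fin.
  have {}pq : (p^-1 + q^-1 = 1)%R.
    by apply: EFin_inj; rewrite EFinD -pq inver gt_eqF.
  rewrite /= -EFinD lee_fin mulrC.
  apply: (le_trans (conjugate_powR s0 t0 p0 q0 pq)).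
  rewrite addrC lerD// ler_piMr ?powR_ge0// invf_le1//.
have {}pq : p = 1%R.
  by move: pq; rewrite invey adde0 => -[pV]; rewrite -[LHS]invrK pV invr1.
rewrite pq /=; case: (leP t 1%R) => [t1|_]; last by rewrite addye// leey.
by rewrite add0e lee_fin powRr1// ler_piMl.
Qed.

Lemma le_1D_phi (p s : R) : (1 <= p)%R -> (0 <= s)%R -> s%:E <= 1 + phi p%:E s.
Proof.
move=> p1 s0; rewrite /= -EFinD lee_fin; have [s1|/ltW s1] := leP s 1%R.
  by apply: (le_trans s1); rewrite lerDl powR_ge0.
by rewrite -[leLHS](powRr1 s0) ler_wpDl// ler_powR.
Qed.

Lemma measurable_fun_powR2 d (T : measurableType d) (D : set T) (f g : T -> R) :
  measurable D -> measurable_fun D f -> measurable_fun D g ->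
  measurable_fun D (fun x => f x `^ g x)%R.
Proof.
move=> mD mf mg; rewrite /powR; apply: measurable_fun_if => //.
- exact: measurable_fun_eqr.
- have -> : (fun t => (g t == 0)%:R%R) = (fun t => if g t == 0%R then 1%R else 0%R :> R).
    by apply/funext => t; case: eqP.
  apply: (@measurable_funS _ _ _ _ D) => //.
  apply: measurable_fun_if => //; exact: measurable_fun_eqr.
- apply: (@measurable_funS _ _ _ _ D) => //.
  apply: measurableT_comp => //; apply: measurable_funM => //.
  exact: measurableT_comp.
Qed.

Lemma measurable_fun_phi d (T : measurableType d) (D : set T) (p : T -> \bar R)
    (u : T -> R) : measurable D -> measurable_fun D p -> measurable_fun D u ->
  measurable_fun D (fun x => phi (p x) (u x)).
Proof.
move=> mD mp mu.
have -> : (fun x => phi (p x) (u x)) = (fun x =>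
    if p x == +oo then (if (u x <= 1)%R then 0 else +oo) else
    if p x == -oo then 0 else (u x `^ fine (p x))%:E).
  by apply/funext => x; case: (p x) => [r||].
have mset (y : \bar R) : measurable_fun D (fun x => p x == y).
  move=> _; apply: (measurable_fun_bool true) => //.
  rewrite (_ : _ `&` _ = D `&` p @^-1` [set y]).
    exact: mp.
  by apply/seteqP; split => x [Dx] /= /eqP.
apply: measurable_fun_if => //.
- apply: (@measurable_funS _ _ _ _ D) => //.
  by apply: measurable_fun_if => //; exact: measurable_fun_ler.
- apply: (@measurable_funS _ _ _ _ D) => //.
  apply: measurable_fun_if => //.
  apply: (@measurable_funS _ _ _ _ D) => //.
  apply/measurable_EFinP; apply: measurable_fun_powR2 => //.
  exact: measurableT_comp.
Qed.

Context {E : normedModType R[i]}.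
Implicit Types (p : R -> \bar R) (u : R -> E).

Lemma luxemburg_ltP p u (c : \bar R) : luxemburg p u < c ->
  exists l : R, [/\ (0 < l)%R, l%:E < c &
    modular p (fun x => l^-1%:C *: u x)%R <= 1].
Proof. by move=> /ereal_inf_lt[_ [l [l0 lu] <-] lc]; exists l. Qed.

Lemma luxemburg_ge0 p u : 0 <= luxemburg p u.
Proof. by apply: le_ereal_inf_tmp => _ [l [l0 _] <-]; rewrite lee_fin ltW. Qed.

End variable_exponent_theory.

Section modular_inequalities.
Context {R : realType} d (T : measurableType d).
Variables (mu : {measure set T -> \bar R}) (D : set T).
Hypothesis mD : measurable D.
Variables (p : T -> R) (q : T -> \bar R).
Hypothesis mp : measurable_fun D p.
Hypothesis mq : measurable_fun D q.
Hypothesis p1 : {ae mu, forall x, D x -> 1 <= p x}.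
Hypothesis q1 : forall x, D x -> (1 <= q x)%E.
Hypothesis pq : {ae mu, forall x, D x -> ((p x)^-1%:E + (q x)^-1 = 1)%E}.
Local Open Scope ereal_scope.

(** Integrates s <= 1 + s^p, valid for p >= 1: on a set of finite measure the
    norm with exponent p(x) dominates the L^1 norm. *)
Lemma modular_le1_integral (u : T -> R) (l : R) : (0 < l)%R ->
  measurable_fun D u -> (forall x, 0 <= u x)%R ->
  \int[mu]_(x in D) phi (p x)%:E (l^-1 * u x)%R <= 1 ->
  \int[mu]_(x in D) (u x)%:E <= l%:E * (mu D + 1).
Proof.
move=> l0 mu_ u0 mod1.
have mphi : measurable_fun D (fun x => phi (p x)%:E (l^-1 * u x)%R).
  apply: measurable_fun_phi => //; first exact/measurable_EFinP.
  exact: measurable_funM.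
apply: (@le_trans _ _ (\int[mu]_(x in D) (l%:E * (1 + phi (p x)%:E (l^-1 * u x)%R)))).
  apply: ae_ge0_le_integral => //.
  - by move=> x _; rewrite lee_fin.
  - exact/measurable_EFinP.
  - move=> x _; apply: mule_ge0; first by rewrite lee_fin ltW.
    by apply: adde_ge0 => //; exact: phi_ge0.
  - by apply: measurable_funeM; apply: emeasurable_funD.
  apply: filterS p1 => x px Dx.
  have -> : (u x)%:E = l%:E * (l^-1 * u x)%R%:E.
    by rewrite -EFinM mulrA divff ?gt_eqF// mul1r.
  apply: lee_wpmul2l; first by rewrite lee_fin ltW.
  by apply: le_1D_phi; [exact: px|rewrite mulr_ge0// invr_ge0 ltW].
rewrite ge0_integralZl//; last 3 first.
- exact: emeasurable_funD.
- by move=> x _; apply: adde_ge0 => //; exact: phi_ge0.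
- by rewrite lee_fin ltW.
apply: lee_wpmul2l; first by rewrite lee_fin ltW.
rewrite ge0_integralD//.
- by rewrite integral_cst// mul1e leeD2l.
- by move=> x _; exact: phi_ge0.
Qed.

(** Pointwise Young inequality for v / l and u / m; each of the two modulars
    contributes 1 to the constant 2. *)
Lemma hoelder_modular (v u : T -> R) (l m : R) : (0 < l)%R -> (0 < m)%R ->
  measurable_fun D v -> measurable_fun D u ->
  (forall x, 0 <= v x)%R -> (forall x, 0 <= u x)%R ->
  \int[mu]_(x in D) phi (q x) (l^-1 * v x)%R <= 1 ->
  \int[mu]_(x in D) phi (p x)%:E (m^-1 * u x)%R <= 1 ->
  \int[mu]_(x in D) (v x * u x)%:E <= (2 * (l * m))%:E.
Proof.
move=> l0 m0 mv mu_ v0 u0 modv modu.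
have mphiv : measurable_fun D (fun x => phi (q x) (l^-1 * v x)%R).
  by apply: measurable_fun_phi => //; exact: measurable_funM.
have mphiu : measurable_fun D (fun x => phi (p x)%:E (m^-1 * u x)%R).
  apply: measurable_fun_phi => //; first exact/measurable_EFinP.
  exact: measurable_funM.
apply: (@le_trans _ _ (\int[mu]_(x in D)
    ((l * m)%:E * (phi (q x) (l^-1 * v x)%R + phi (p x)%:E (m^-1 * u x)%R)))).
  apply: ae_ge0_le_integral => //.
  - by move=> x _; rewrite lee_fin mulr_ge0.
  - by apply/measurable_EFinP; exact: measurable_funM.
  - move=> x _; apply: mule_ge0; first by rewrite lee_fin ltW// mulr_gt0.
    by apply: adde_ge0; exact: phi_ge0.
  - by apply: measurable_funeM; apply: emeasurable_funD.
  apply: filterS2 p1 pq => x px pqx Dx.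
  have -> : (v x * u x)%:E = (l * m)%:E * ((l^-1 * v x) * (m^-1 * u x))%R%:E.
    rewrite -EFinM; congr (_%:E); field.
    by rewrite !gt_eqF.
  apply: lee_wpmul2l; first by rewrite lee_fin ltW// mulr_gt0.
  apply: young_phi; [exact: px|exact: q1|exact: pqx|..].
    by rewrite mulr_ge0// invr_ge0 ltW.
  by rewrite mulr_ge0// invr_ge0 ltW.
rewrite ge0_integralZl//; last 3 first.
- exact: emeasurable_funD.
- by move=> x _; apply: adde_ge0 => //; exact: phi_ge0.
- by rewrite lee_fin mulr_ge0// ltW.
rewrite [(2 * _)%R]mulrC [leRHS]EFinM; apply: lee_wpmul2l; first by rewrite lee_fin ltW// mulr_gt0.
rewrite ge0_integralD//.
- by apply: (le_trans (leeD modv modu)).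
- by move=> x _; exact: phi_ge0.
- by move=> x _; exact: phi_ge0.
Qed.

End modular_inequalities.

Lemma ae_leb_mono {R : realType} (P Q : R -> Prop) :
  (forall x, P x -> Q x) -> {ae leb, forall x : R, P x} -> {ae leb, forall x : R, Q x}.
Proof.
move=> PQ [N [mN N0 sN]]; exists N; split => // x nQ; apply: sN.
by move=> /PQ.
Qed.

Section luxemburg_inequalities.
Context {R : realType} {X : normedModType R[i]}.
Variables (p : R -> R) (q : R -> \bar R).
Hypothesis hp : exponent_Dplus p.
Local Open Scope ereal_scope.
Local Notation pE := (fun x => (p x)%:E).

Let mp : measurable_fun I01 (p : lebesgueR R -> R).
Proof. by case: hp. Qed.

Lemma exponent_ge1 : {ae leb, forall x : R, I01 x -> (1 <= p x)%R}.
Proof.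
case: hp => _ p1 pae _; apply: ae_leb_mono pae => x px Dx.
by rewrite -lee_fin; apply: le_trans p1 _; case/andP: (px Dx).
Qed.

Lemma luxemburg_L1 (u : R -> X) (c : R) : strongly_measurable leb I01 u ->
  luxemburg pE u < c%:E ->
  \int[leb]_(x in I01) (normr_of (u x))%:E <= (2 * c)%:E.
Proof.
move=> mu /luxemburg_ltP[l [l0 lc mod1]].
have mnu := strongly_measurable_norm leb_complete (@measurable_I01 R) mu.
have h := @modular_le1_integral R _ (lebesgueR R) leb I01 (@measurable_I01 R) p
   mp exponent_ge1 (fun x => normr_of (u x)) l l0 mnu (fun x => normr_of_ge0 (u x)).
apply: (le_trans (h _)).
  move: mod1; rewrite /modular; under eq_integral do rewrite normr_ofZ gtr0_norm ?invr_gt0//.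
  by [].
rewrite leb_I01 -EFinD -EFinM lee_fin mulrC ler_wpM2l//.
by rewrite -lee_fin ltW.
Qed.

Hypothesis hq : exponent_P q.
Hypothesis hpq : {ae leb, forall x : R, I01 x -> ((p x)^-1%:E + (q x)^-1 = 1)%E}.

Lemma luxemburg_hoelder (v : R -> R) (u : R -> X) (l c : R) : (0 < l)%R ->
  measurable_fun I01 (v : lebesgueR R -> R) -> (forall x, 0 <= v x)%R ->
  modular q (fun x => l^-1%:C *: ((v x)%:C : R[i]^o))%R <= 1 ->
  strongly_measurable leb I01 u -> luxemburg pE u < c%:E ->
  \int[leb]_(x in I01) (v x * normr_of (u x))%:E <= (2 * (l * c))%:E.
Proof.
move=> l0 mv v0 modv mu /luxemburg_ltP[m [m0 mc modu]].
have mnu := strongly_measurable_norm leb_complete (@measurable_I01 R) mu.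
case: hq => mq q1.
have h := @hoelder_modular R _ (lebesgueR R) leb I01 (@measurable_I01 R) p q
   mp mq exponent_ge1 q1 hpq v (fun x => normr_of (u x)) l m l0 m0 mv mnu v0
   (fun x => normr_of_ge0 (u x)).
apply: (le_trans (h _ _)).
- move: modv; rewrite /modular; under eq_integral do
    rewrite normr_ofZ normr_of_real gtr0_norm ?invr_gt0// (ger0_norm (v0 _)).
  by [].
- move: modu; rewrite /modular; under eq_integral do rewrite normr_ofZ gtr0_norm ?invr_gt0//.
  by [].
by rewrite lee_fin !ler_wpM2l// ?ltW// -lte_fin.
Qed.

End luxemburg_inequalities.

(** * Limits of translates *)

Section steinhaus.
Context {R : realType}.
Implicit Types (B : set R).

(** Otherwise B fills at most 3/4 of every interval. Covering B by intervals of
    total length less than 5/4 |B| would then give |B| <= 15/16 |B|. *)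
Lemma interval_density B : measurable (B : set (lebesgueR R)) ->
  (0 < leb B)%E -> (leb B < +oo)%E ->
  exists a b : R, a < b /\ ((3 / 4 * (b - a))%:E < leb (B `&` `]a, b[%classic))%E.
Proof.
move=> mB B0 Boo; apply: contrapT => nab.
(* The bound extends to empty intervals, which occur in covers. *)
have {}nab (a b : R) : (leb (B `&` `]a, b[%classic) <=
    (3 / 4)%:E * wlength idfun `]a, b[%classic)%E.
  rewrite wlength_itv/= lte_fin; case: ltP => [ab|ba]; last first.
    by rewrite set_itv_ge ?bnd_simp -?leNgt// setI0 measure0 mule0.
  rewrite leNgt -EFinB -EFinM; apply/negP => h; apply: nab; exists a, b; split => //.
have Bfin : leb B \is a fin_num by rewrite ge0_fin_numE.
have m0 : 0 < fine (leb B) by rewrite fine_gt0// B0.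
have [F [Fitv BF] Fsum] : exists2 F, open_itv_cover B F &
    (\sum_(k <oo) wlength idfun (F k) < (5 / 4 * fine (leb B))%:E)%E.
  have : (leb B < (5 / 4 * fine (leb B))%:E)%E by rewrite -[ltLHS]fineK// lte_fin; lra.
  rewrite [in X in (X < _)%E -> _]lebE outer_measure_open_itv_cover.
  by move=> /ereal_inf_lt[_ [F cF <-] sF]; exists F.
have mF k : measurable (F k : set (lebesgueR R)).
  by have [[a b] ->] := Fitv k; exact: leb_measurable_itv.
have : (leb B <= \sum_(k <oo) (3 / 4)%:E * wlength idfun (F k))%E.
  apply: (@le_trans _ _ (\sum_(k <oo) leb (B `&` F k))%E).
    apply: (@measure_sigma_subadditive _ _ _ leb B (fun k => B `&` F k)) => //.
      by move=> k; exact: measurableI.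
    by move=> x Bx; have [k _ Fk] := BF _ Bx; exists k.
  by apply: lee_nneseries => // k _; have [[a b] ->] := Fitv k; exact: nab.
rewrite nneseriesZl; last first.
  by move=> k _; have [[a b] ->] := Fitv k; exact: wlength_itv_ge0.
apply/negP; rewrite -ltNge.
apply: (@lt_trans _ _ ((3 / 4)%:E * (5 / 4 * fine (leb B))%:E)%E).
  by rewrite lte_pmul2l// lte_fin; lra.
by rewrite -EFinM -[ltRHS]fineK// lte_fin; lra.
Qed.

(** If C, the part of B in an interval of length L, has measure more than 3/4 L,
    then C and its translate by less than L/4 both lie in an interval of length
    3/2 L, while their measures add up to more than that. *)
Lemma translate_overlap B : measurable (B : set (lebesgueR R)) ->
  (0 < leb B)%E -> (leb B < +oo)%E ->
  exists e delta : R, [/\ 0 < e, 0 < delta & forall s : R, `|s| < e ->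
    (delta%:E <= leb (B `&` [set x : R | B (x + s)%R]))%E].
Proof.
move=> mB B0 Boo; have [a [b [ab dens]]] := interval_density mB B0 Boo.
set C := B `&` `]a, b[%classic in dens.
have mC : measurable (C : set (lebesgueR R)).
  by apply: measurableI => //; exact: leb_measurable_itv.
have Cfin : leb C \is a fin_num.
  rewrite ge0_fin_numE//; apply: le_lt_trans Boo.
  by apply: le_measure; rewrite ?inE//; exact: subIsetl.
exists ((b - a) / 4), (2 * fine (leb C) - 3 / 2 * (b - a)); split; first by lra.
  by move: dens; rewrite -[ltRHS]fineK// lte_fin; lra.
move=> s sab; pose Cs := [set x : R | C (x + s)].
have mCs : measurable (Cs : set (lebesgueR R)) by exact: leb_measurable_shift.
have Cs_eq : leb Cs = leb C by exact: leb_shift.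
apply: (@le_trans _ _ (leb (C `&` Cs))); last first.
  apply: le_measure; rewrite ?inE.
  - exact: measurableI.
  - by apply: measurableI => //; exact: leb_measurable_shift.
  - by move=> x [[Bx _] [Bxs _]].
have Ifin : leb (C `&` Cs) \is a fin_num.
  rewrite ge0_fin_numE//; apply: le_lt_trans (_ : leb C < +oo)%E; last first.
    by rewrite -ge0_fin_numE.
  by apply: le_measure; rewrite ?inE//; exact: measurableI.
have : (leb (C `|` Cs) <= (3 / 2 * (b - a))%:E)%E.
  apply: (@le_trans _ _ (leb `](a - (b - a) / 4), (b + (b - a) / 4)[%classic)).
    apply: le_measure; rewrite ?inE.
    - exact: measurableU.
    - exact: leb_measurable_itv.
    - move: sab; rewrite ltr_norml => /andP[s1 s2].
      move=> x [[_]|[_]]; rewrite /= !in_itv/= => /andP[? ?]; apply/andP; split; lra.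
  by rewrite leb_itv_oo lee_fin ge_max; apply/andP; split; lra.
rewrite measureUfinr//; last by rewrite -ge0_fin_numE// Cs_eq.
rewrite Cs_eq; move: Cfin Ifin.
case: (leb C) => [c||]// _; case: (leb (C `&` Cs)) => [d||]// _ /=.
rewrite -?EFinB -?EFinD -?EFinB !lee_fin; lra.
Qed.

Context {E : normedModType R[i]}.

Lemma normr_of_far (x y z : E) (c : R) :
  2 * c < normr_of (y - z) -> normr_of (x - z) < c -> c < normr_of (x - y).
Proof. by have := normr_of_tri x y z; rewrite (normr_ofB y x); lra. Qed.

Lemma normr_of_near (x y z : E) (c : R) :
  normr_of (x - z) < c -> 3 * c < normr_of (x - y) -> 2 * c < normr_of (y - z).
Proof. by have := normr_of_tri z x y; rewrite (normr_ofB z y); lra. Qed.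

(** If F and H differ on a set of positive measure, then for some e j and some
    c > 0 the set B where |F - e j| < c and 2 c < |H - e j| has positive measure.
    For n large B meets its translate by a n in measure at least delta, and on
    the overlap |F (x + a n) - H x| > c, so that the integral stays above
    c delta. *)
Lemma translate_limit_unique (F H : R -> E) (a : nat -> R) :
  strongly_measurable (T := lebesgueR R) leb setT F ->
  strongly_measurable (T := lebesgueR R) leb setT H ->
  a n @[n --> \oo] --> 0 ->
  (\int[leb]_(x in I01) (normr_of (F (x + a n)%R - H x)%R)%:E)%E
    @[n --> \oo] --> 0%E ->
  {ae leb, forall x : R, I01 x -> F x = H x}.
Proof.
move=> mF mH a0 FH.
have mI := @measurable_I01 R.
have mT : measurable (setT : set (lebesgueR R)) by exact: measurableT.
have [e eF] := strongly_measurable_separable mF.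
pose B j m : set R := I01 `&` ([set x | normr_of (F x - e j) < m.+1%:R^-1] `&`
  [set x | 2 / m.+1%:R < normr_of (H x - e j)]).
have mB j m : measurable (B j m : set (lebesgueR R)).
  apply: measurableI; first exact: mI.
  apply: measurableI; rewrite -[X in measurable X]setTI.
    exact: (measurable_norm_lt leb_complete (e j) _ mT mF).
  exact: (measurable_norm_gt leb_complete (e j) _ mT mH).
have B0 j m : leb (B j m) = 0%E.
  apply/eqP; apply: contrapT => /negP; rewrite -measure_gt0 => Bpos.
  have Boo : (leb (B j m) < +oo)%E.
    apply: (@le_lt_trans _ _ (leb (@I01 R))); last by rewrite leb_I01 ltry.
    by apply: le_measure; rewrite ?inE//; exact: subIsetl.
  have [eps [del [eps0 del0 overlap]]] := translate_overlap (mB j m) Bpos Boo.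
  have del' : 0 < m.+1%:R^-1 * del by rewrite mulr_gt0// invr_gt0.
  near \oo => n.
  have an : `|a n| < eps by near: n; move/cvgr0Pnorm_lt : a0; exact.
  have : (\int[leb]_(x in I01) (normr_of (F (x + a n)%R - H x)%R)%:E <
     (m.+1%:R^-1 * del)%:E)%E.
    by near: n; exact: cvge0_lt FH del'.
  apply/negP; rewrite -leNgt.
  pose C := B j m `&` [set x : R | B j m (x + a n)].
  have mC : measurable (C : set (lebesgueR R)).
    by apply: measurableI => //; exact: leb_measurable_shift.
  have mFH : measurable_fun I01 ((fun x : R => (normr_of (F (x + a n)%R - H x)%R)%:E) : lebesgueR R -> \bar R).
    apply/measurable_EFinP; apply: (strongly_measurable_subr leb_complete mI).
      have := strongly_measurable_shift (a n) mF.
      by apply: strongly_measurable_subset => x _.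
    exact: strongly_measurable_subset mH.
  apply: (@le_trans _ _ (\int[leb]_(x in C) (normr_of (F (x + a n)%R - H x)%R)%:E)%E).
    apply: (@le_trans _ _ (\int[leb]_(x in C) (cst (m.+1%:R^-1)%:E) x)%E).
      by rewrite integral_cst// EFinM lee_pmul2l// ?lte_fin ?invr_gt0//; exact: overlap.
    apply: (ge0_le_integral leb mC).
    - by move=> x _; rewrite lee_fin invr_ge0.
    - exact: measurable_cst.
    - by apply: measurable_funS mFH => // x [[]].
    - move=> x [[_ [_ Hx]] [_ [Fx _]]]; rewrite lee_fin.
      by apply: ltW; apply: normr_of_far Hx Fx.
  apply: (ge0_subset_integral leb mC mI mFH).
    by move=> x _; rewrite lee_fin normr_of_ge0.
  by move=> x [[]].
have : (@leb R).-negligible (\bigcup_j \bigcup_m (B j m : set (lebesgueR R))).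
  apply: negligible_bigcup => j; apply: negligible_bigcup => m.
  by exists (B j m); split.
move/(negligibleU eF); apply: negligibleS => x /= FHx.
apply: contrapT => /not_orP[/contrapT ex nB].
apply: FHx => Ix; apply: contrapT => FHx; apply: nB.
have d0 : 0 < normr_of (F x - H x).
  by apply: normr_of_gt0; rewrite subr_eq0; apply/eqP.
have d3 : 0 < normr_of (F x - H x) / 3 by rewrite divr_gt0.
near \oo => m.
have m0 : 0 < (m.+1%:R^-1 : R) by rewrite invr_gt0.
have [j je] := ex I _ m0.
have mm : m.+1%:R^-1 < normr_of (F x - H x) / 3.
  near: m; exact: near_infty_natSinv_lt (PosNum d3).
have mm3 : 3 * m.+1%:R^-1 < normr_of (F x - H x) by move: mm; rewrite ltr_pdivlMr// mulrC.
exists j => //; exists m => //; split => //; split => //=.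
exact: normr_of_near je mm3.
Unshelve. all: by end_near. Qed.

End steinhaus.

(** * Series over unit cells *)

Lemma trivIset_itvoc_nat {R : realType} :
  trivIset setT (fun k : nat => `]k%:R, k%:R + 1]%classic : set R).
Proof.
move=> i j _ _ [x [/=]]; rewrite !in_itv/= => /andP[ix xi] /andP[jx xj].
have ij : (i < j.+1)%N by rewrite -(ltr_nat R) -natr1 (lt_le_trans ix xj).
have ji : (j < i.+1)%N by rewrite -(ltr_nat R) -natr1 (lt_le_trans jx xi).
by apply/eqP; rewrite eqn_leq -ltnS ij -ltnS ji.
Qed.

Lemma bigcup_itvoc_nat {R : realType} :
  \bigcup_k (`]k%:R, k%:R + 1]%classic : set R) = `]0, +oo[%classic.
Proof.
apply/seteqP; split => [x [k _ /=]|x /=].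
  by rewrite !in_itv/= andbT => /andP[kx _]; exact: le_lt_trans kx.
rewrite in_itv/= andbT => x0.
have ex : exists n : nat, x <= n%:R + 1.
  by exists (Num.truncn x); rewrite natr1 ltW// truncnS_gt.
case: (ex_minnP ex) => n xn nmin; exists n => //=; rewrite in_itv/= xn andbT.
case: n xn nmin => [//|n] _ nmin; rewrite ltNge; apply/negP => xn.
by have := nmin n; rewrite natr1 => /(_ xn); rewrite ltnn.
Qed.

Lemma cvge0_squeeze {R : realType} {T : Type} {F : set_system T} {FF : Filter F}
    (u : T -> \bar R) : (forall x, 0 <= u x)%E ->
  (forall e : R, 0 < e -> \forall x \near F, (u x <= e%:E)%E) ->
  u x @[x --> F] --> 0%E.
Proof.
move=> u0 ule; have ufin x (e : R) : (u x <= e%:E)%E -> u x \is a fin_num.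
  by move=> ue; rewrite ge0_fin_numE// (le_lt_trans ue)// ltry.
apply/fine_cvgP; split; first by have := ule _ ltr01; apply: filterS => x; exact: ufin.
apply/cvgr0Pnorm_le => e e0; have := ule _ e0; apply: filterS => x ux /=.
by rewrite ger0_norm ?fine_ge0// -lee_fin fineK// (ufin x e).
Qed.

(** Tannery's theorem, as dominated convergence for the counting measure. *)
Lemma dominated_nneseries_cvg0 {R : realType} (a : nat -> nat -> \bar R)
    (dom : nat -> \bar R) :
  (forall n k, 0 <= a n k)%E -> (forall n k, a n k <= dom k)%E ->
  (\sum_(0 <= k <oo) dom k < +oo)%E ->
  (forall k, a n k @[n --> \oo] --> 0%E) ->
  (\sum_(0 <= k <oo) a n k)%E @[n --> \oo] --> 0%E.
Proof.
move=> a0 adom domoo acvg.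
have dom0 k : (0 <= dom k)%E by exact: le_trans (a0 0%N k) (adom 0%N k).
have := @dominated_convergence _ _ R counting setT measurableT a (cst 0%E) dom.
case.
- by [].
- by [].
- by apply: aeW.
- apply/integrableP; split => //.
  under eq_integral do rewrite gee0_abs//.
  by rewrite ge0_integral_count.
- by apply: aeW => k n _; rewrite gee0_abs.
move=> _ _; rewrite integral0; apply: cvg_trans; apply: near_eq_cvg.
by apply: nearW => n /=; rewrite ge0_integral_count.
Qed.

(** * Convolution with an operator-valued kernel *)

Section kernel_integral.
Context {R : realType} {X : normedModType R[i]} {Y : completeNormedModType R[i]}.
Variables (p : R -> R) (q : R -> \bar R).
Hypothesis hp : exponent_Dplus p.
Hypothesis hq : exponent_P q.
Hypothesis hpq : {ae leb, forall x : R, I01 x -> ((p x)^-1%:E + (q x)^-1 = 1)%E}.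
Variable Rf : R -> {linear X -> Y}.
Hypothesis Rf_bounded : forall t : R, 0 < t -> continuous (Rf t).
Hypothesis Rf_continuous : forall (x : X) (t : R), 0 < t ->
  {for t, continuous (fun s : R => Rf s x)}.
Hypothesis Rf_summable : (\sum_(0 <= k <oo)
  luxemburg q (fun x : R => (opnorm (Rf (x + k%:R)%R))%:C : R[i]^o) < +oo)%E.

Local Notation pos := (`]0, +oo[%classic : set (lebesgueR R)).
Local Notation pE := (fun x => (p x)%:E).

(** The infimum defining a Luxemburg norm need not be attained and may be 0.
    Exceeding it by at most 2^-(k+1) gives positive admissible scales r k that
    are still summable. *)
Lemma summable_scales : exists r : nat -> R, [/\ forall k, 0 < r k,
  (\sum_(0 <= k <oo) (r k)%:E < +oo)%E &
  forall k, (modular q (fun x : R => (r k)^-1%:C *: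
    ((opnorm (Rf (x + k%:R)%R))%:C : R[i]^o))%R <= 1)%E].
Proof.
set L := fun k : nat => luxemburg q (fun x : R => (opnorm (Rf (x + k%:R)%R))%:C : R[i]^o).
have L0 k : (0 <= L k)%E by exact: luxemburg_ge0.
have Lfin k : L k \is a fin_num.
  rewrite ge0_fin_numE//; apply: le_lt_trans Rf_summable.
  apply: (@le_trans _ _ (\sum_(0 <= i < k.+1) L i)%E).
    by rewrite big_nat_recr//= leeDr// sume_ge0.
  by apply: nneseries_lim_ge => i _ _; exact: L0.
have /choice[r rP] (k : nat) : exists l : R, [/\ 0 < l,
    (l%:E < L k + (1 / (2 ^ k.+1)%:R)%:E)%E & (modular q (fun x : R => l^-1%:C *:
    ((opnorm (Rf (x + k%:R)%R))%:C : R[i]^o))%R <= 1)%E].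
  apply: luxemburg_ltP; rewrite -/(L k) -(fineK (Lfin k)) -EFinD lte_fin ltrDl.
  by rewrite divr_gt0// ltr0n expn_gt0.
exists r; split => [k||k]; try by case: (rP k).
apply: (@le_lt_trans _ _ (\sum_(0 <= k <oo) (L k + (1 / (2 ^ k.+1)%:R)%:E))%E).
  apply: lee_nneseries => k _; last by case: (rP k) => _ /ltW.
  by rewrite lee_fin; case: (rP k) => /ltW.
apply: (le_lt_trans (epsilon_trick xpredT L0 ler01)).
by rewrite lte_add_pinfty// ltry.
Qed.

Lemma measurable_opnorm_cell (k : nat) :
  measurable_fun I01 ((fun x : R => opnorm (Rf (x + k%:R))) : lebesgueR R -> R).
Proof.
(* For k = 0 nothing is known about R at the endpoint x = 0. *)
have -> : (I01 : set (lebesgueR R)) = [set 0] `|` `]0, 1]%classic.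
  rewrite /I01; apply/seteqP; split => x /=; rewrite !in_itv/=.
    move=> /andP[]; rewrite le_eqVlt => /predU1P[<- _|x0 x1]; first by left.
    by right; rewrite x0.
  by move=> [->|/andP[/ltW-> ->]]; rewrite ?lexx ?ler01.
have m0 : measurable ([set 0] : set (lebesgueR R)).
  by rewrite -set_itv1; exact: leb_measurable_itv.
have m1 : measurable (`]0, 1]%classic : set (lebesgueR R)) by exact: leb_measurable_itv.
apply/(measurable_funU _ m0 m1); split; first exact: measurable_fun_set1.
have mpos : measurable pos by exact: leb_measurable_itv.
have := measurable_fun_shift (c := k%:R) mpos (measurable_opnorm Rf_bounded Rf_continuous).
apply: measurable_funS; first exact: leb_measurable_shift.
move=> x /=; rewrite !in_itv/= andbT => /andP[x0 _].
by rewrite ltr_wpDr.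
Qed.

Definition cell_cost (v : R -> X) (k : nat) : \bar R :=
  (\int[leb]_(x in I01) (opnorm (Rf (x + k%:R)) * normr_of (v (x + k%:R)))%:E)%E.

(** The bound is strict so that some admissible scale lies below c. *)
Definition cell_bounded (v : R -> X) (c : R) : Prop :=
  strongly_measurable (T := lebesgueR R) leb setT v /\
  forall k : nat, (luxemburg pE (fun x => v (x + k%:R)%R) < c%:E)%E.

Lemma cell_strongly_measurable (v : R -> X) (t : R) :
  strongly_measurable (T := lebesgueR R) leb setT v ->
  strongly_measurable leb I01 (fun x => v (x + t)).
Proof.
move=> /(strongly_measurable_shift t); exact: strongly_measurable_subset.
Qed.

Lemma measurable_cost (v : R -> X) :
  strongly_measurable (T := lebesgueR R) leb setT v ->
  measurable_fun pos ((fun t : R => opnorm (Rf t) * normr_of (v t)) : lebesgueR R -> R).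
Proof.
have mpos : measurable pos by exact: leb_measurable_itv.
move=> mv; apply: measurable_funM.
  exact: (measurable_opnorm Rf_bounded Rf_continuous).
apply: (strongly_measurable_norm leb_complete mpos).
by apply: strongly_measurable_subset mv.
Qed.

Lemma measurable_cell_cost (v : R -> X) (k : nat) :
  strongly_measurable (T := lebesgueR R) leb setT v ->
  measurable_fun I01
   ((fun x : R => opnorm (Rf (x + k%:R)) * normr_of (v (x + k%:R))) : lebesgueR R -> R).
Proof.
move=> mv; apply: measurable_funM; first exact: measurable_opnorm_cell.
apply: (strongly_measurable_norm leb_complete (@measurable_I01 R)).
exact: cell_strongly_measurable.
Qed.

(** The half line is the disjoint union of the intervals ]k, k+1], each of which
    is translated into [0, 1]. *)
Lemma pos_integral_le_cells (v : R -> X) :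
  strongly_measurable (T := lebesgueR R) leb setT v ->
  (\int[leb]_(t in pos) (opnorm (Rf t) * normr_of (v t))%:E <=
   \sum_(0 <= k <oo) cell_cost v k)%E.
Proof.
move=> mv.
have cost0 t : (0 <= (opnorm (Rf t) * normr_of (v t))%:E)%E.
  by rewrite lee_fin mulr_ge0// ?opnorm_ge0 ?normr_of_ge0.
have mcost := measurable_cost mv.
have mcell k : measurable (`]k%:R, k%:R + 1]%classic : set (lebesgueR R)).
  exact: leb_measurable_itv.
rewrite -[X in integral _ X _]bigcup_itvoc_nat.
rewrite ge0_integral_bigcup; last 4 first.
- exact: mcell.
- by rewrite bigcup_itvoc_nat; exact/measurable_EFinP.
- by move=> x _; exact: cost0.
- exact: trivIset_itvoc_nat.
apply: lee_nneseries => [k _ _|k _]; first exact: integral_ge0.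
have subpos : (`]k%:R, k%:R + 1]%classic : set (lebesgueR R)) `<=` pos.
  move=> t /=; rewrite !in_itv/= andbT => /andP[kt _]; exact: le_lt_trans kt.
rewrite (ge0_integral_shift k%:R (mcell k)); last 2 first.
- apply/measurable_EFinP; apply: measurable_funS mcost => //; exact: leb_measurable_itv.
- by move=> x _; exact: cost0.
apply: ge0_subset_integral.
- exact: leb_measurable_shift.
- exact: measurable_I01.
- by apply/measurable_EFinP; exact: measurable_cell_cost.
- by move=> x _; exact: cost0.
- move=> x /=; rewrite /I01/= !in_itv/= => /andP[]; rewrite ltrDr addrC lerD2l.
  by move=> /ltW -> ->.
Qed.

Lemma cell_cost_ge0 v k : (0 <= cell_cost v k)%E.
Proof.
by apply: integral_ge0 => x _; rewrite lee_fin mulr_ge0// ?opnorm_ge0 ?normr_of_ge0.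
Qed.

Lemma cell_cost_le (r : nat -> R) v k c : 0 < r k ->
  (modular q (fun x : R => (r k)^-1%:C *:
    ((opnorm (Rf (x + k%:R)%R))%:C : R[i]^o))%R <= 1)%E ->
  strongly_measurable (T := lebesgueR R) leb setT v ->
  (luxemburg pE (fun x => v (x + k%:R)%R) < c%:E)%E ->
  (cell_cost v k <= (2 * (r k * c))%:E)%E.
Proof.
move=> rk0 modr mv lc.
apply: (luxemburg_hoelder hp hq hpq rk0 (measurable_opnorm_cell k) _ modr _ lc).
  by move=> x; exact: opnorm_ge0.
exact: cell_strongly_measurable.
Qed.

Lemma cell_cost_sub_le (v w : R -> X) k :
  strongly_measurable (T := lebesgueR R) leb setT v ->
  strongly_measurable (T := lebesgueR R) leb setT w ->
  (cell_cost (fun x => (v x - w x)%R) k <= cell_cost v k + cell_cost w k)%E.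
Proof.
move=> mv mw.
have cost0 (z : R -> X) (x : R) :
    (0 <= (opnorm (Rf (x + k%:R)) * normr_of (z (x + k%:R)))%:E)%E.
  by rewrite lee_fin mulr_ge0// ?opnorm_ge0 ?normr_of_ge0.
have mI := @measurable_I01 R.
have mcv : measurable_fun I01 ((fun x : R => (opnorm (Rf (x + k%:R)) *
    normr_of (v (x + k%:R)))%:E) : lebesgueR R -> \bar R).
  by apply/measurable_EFinP; exact: measurable_cell_cost.
have mcw : measurable_fun I01 ((fun x : R => (opnorm (Rf (x + k%:R)) *
    normr_of (w (x + k%:R)))%:E) : lebesgueR R -> \bar R).
  by apply/measurable_EFinP; exact: measurable_cell_cost.
rewrite /cell_cost -(ge0_integralD leb mI (fun x _ => cost0 v x) mcv
  (fun x _ => cost0 w x) mcw).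
apply: (ge0_le_integral leb mI).
- by move=> x _; exact: (cost0 (fun x => v x - w x)).
- apply/measurable_EFinP; apply: measurable_funM; first exact: measurable_opnorm_cell.
  apply: (strongly_measurable_subr leb_complete mI); exact: cell_strongly_measurable.
- exact: emeasurable_funD.
- move=> x _; rewrite -EFinD lee_fin -mulrDr ler_wpM2l ?opnorm_ge0//.
  by apply: le_trans (normr_ofD _ _) _; rewrite normr_ofN.
Qed.

Definition kernel_integral (v : R -> X) : Y :=
  bochner_integral (T := lebesgueR R) leb pos (fun t : R => Rf t (v t)).

Lemma kernel_integrable v c : cell_bounded v c ->
  bochner_integrable (T := lebesgueR R) leb pos (fun t : R => Rf t (v t)).
Proof.
move=> [mv vc]; have [r [r0 rsum rmod]] := summable_scales.
have mpos : measurable pos by exact: leb_measurable_itv.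
have mRv : strongly_measurable (T := lebesgueR R) leb pos (fun t : R => Rf t (v t)).
  apply: (strongly_measurable_apply Rf_bounded Rf_continuous).
  exact: strongly_measurable_subset mv.
apply: (integrable_norm_bochner leb_complete mpos mRv).
have c0 : 0 < c by rewrite -lte_fin; apply: le_lt_trans (vc 0%N); exact: luxemburg_ge0.
apply: (@le_lt_trans _ _ (\sum_(0 <= k <oo) cell_cost v k)%E); last first.
  apply: (@le_lt_trans _ _ (\sum_(0 <= k <oo) (2 * c)%:E * (r k)%:E)%E).
    apply: lee_nneseries => [k _ _|k _]; first exact: cell_cost_ge0.
    apply: le_trans (cell_cost_le (r0 k) (rmod k) mv (vc k)) _.
    by rewrite -EFinM lee_fin -mulrA (mulrC c).
  rewrite nneseriesZl; last by move=> k _; rewrite lee_fin ltW.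
  by rewrite lte_mul_pinfty// lee_fin mulr_ge0// ltW.
apply: le_trans (pos_integral_le_cells mv).
apply: (ge0_le_integral leb mpos).
- by move=> x _; rewrite lee_fin normr_of_ge0.
- by apply/measurable_EFinP; exact: (strongly_measurable_norm leb_complete mpos mRv).
- by apply/measurable_EFinP; exact: (measurable_cost mv).
- move=> t /=; rewrite in_itv/= andbT => t0; rewrite lee_fin; apply: opnormP.
  exact: Rf_bounded.
Qed.

Lemma kernel_integralB_le (v w : R -> X) c : cell_bounded v c -> cell_bounded w c ->
  ((normr_of (kernel_integral v - kernel_integral w))%:E <=
  \sum_(0 <= k <oo) cell_cost (fun x => v x - w x)%R k)%E.
Proof.
move=> vc wc; have mpos : measurable pos by exact: leb_measurable_itv.
have iv := kernel_integrable vc; have iw := kernel_integrable wc.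
have mvw : strongly_measurable (T := lebesgueR R) leb setT (fun x => v x - w x).
  by apply: strongly_measurableB; [case: vc|case: wc].
apply: (le_trans (bochner_integralB_le leb_complete mpos iv iw)).
apply: le_trans (pos_integral_le_cells mvw).
apply: (ge0_le_integral leb mpos).
- by move=> x _; rewrite lee_fin normr_of_ge0.
- apply/measurable_EFinP.
  by apply: (strongly_measurable_subr leb_complete mpos); [case: iv|case: iw].
- by apply/measurable_EFinP; exact: (measurable_cost mvw).
- move=> t /=; rewrite in_itv/= andbT => t0; rewrite lee_fin -linearB; apply: opnormP.
  exact: Rf_bounded.
Qed.

(** The cost of v n - w on the k-th cell is at most 4 c r k, which is summable,
    and tends to 0 for fixed k. *)
Lemma kernel_integral_cvg (v : nat -> R -> X) (w : R -> X) c :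
  (forall n, cell_bounded (v n) c) -> cell_bounded w c ->
  (forall k : nat, luxemburg pE (fun x => v n (x + k%:R) - w (x + k%:R))
     @[n --> \oo] --> 0%E) ->
  kernel_integral (v n) @[n --> \oo] --> kernel_integral w.
Proof.
move=> vc wc vw; have [r [r0 rsum rmod]] := summable_scales.
have c0 : 0 < c.
  by rewrite -lte_fin; apply: le_lt_trans (wc.2 0%N); exact: luxemburg_ge0.
have cost_ge0 := cell_cost_ge0.
pose dom k : \bar R := ((4 * c)%:E * (r k)%:E)%E.
have dom0 k : (0 <= dom k)%E by rewrite mule_ge0// lee_fin ?mulr_ge0// ltW.
have cost_dom n k : (cell_cost (fun x => (v n x - w x)%R) k <= dom k)%E.
  apply: (le_trans (cell_cost_sub_le k (vc n).1 wc.1)).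
  apply: (le_trans (leeD (cell_cost_le (r0 k) (rmod k) (vc n).1 ((vc n).2 k))
                         (cell_cost_le (r0 k) (rmod k) wc.1 (wc.2 k)))).
  by rewrite /dom -EFinD -EFinM lee_fin; lra.
have cell0 k : cell_cost (fun x => v n x - w x) k @[n --> \oo] --> 0%E.
  apply: cvge0_squeeze => [n|e e0]; first exact: cost_ge0.
  have e0' : 0 < e / (2 * r k) by rewrite divr_gt0// mulr_gt0.
  apply: filterS (cvge0_lt (vw k) e0') => n lux.
  apply: le_trans (cell_cost_le (r0 k) (rmod k) _ lux) _.
    by apply: strongly_measurableB; [case: (vc n)|case: wc].
  rewrite lee_fin [leLHS](_ : _ = e)//; field.
  by rewrite gt_eqF.
have sum0 : (\sum_(0 <= k <oo) cell_cost (fun x => (v n x - w x)%R) k)%E @[n --> \oo] --> 0%E.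
  apply: (dominated_nneseries_cvg0 (dom := dom)) => //.
  rewrite nneseriesZl; last by move=> k _; rewrite lee_fin ltW.
  by rewrite lte_mul_pinfty// lee_fin mulr_ge0// ltW.
apply/normr_of_cvgP => e e0; apply: filterS (cvge0_lt sum0 e0) => n sumn.
rewrite normr_ofB -lte_fin; apply: le_lt_trans sumn.
exact: kernel_integralB_le (vc n) wc.
Qed.

Local Notation K := kernel_integral.
Implicit Types f h : R -> X.

Lemma memLSp_cell_bounded f : memLSp pE f ->
  exists c, forall t, cell_bounded (fun x => f (x + t)) c.
Proof.
move=> [mf _]; set S := ereal_sup _ => Soo.
have luxS t : (luxemburg pE (fun x => f (x + t)%R) <= S)%E.
  by apply: ereal_sup_ubound; exists t.
have Sfin : S \is a fin_num.
  rewrite ge0_fin_numE//; apply: le_trans (luxS 0); exact: luxemburg_ge0.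
exists (fine S + 1) => t; split; first exact: (strongly_measurable_shift t mf).
move=> k; apply: (@le_lt_trans _ _ S); last first.
  by rewrite -[ltLHS]fineK// lte_fin ltrDl.
rewrite (_ : (fun x => _) = (fun x => f (x + (k%:R + t)))); first exact: luxS.
by apply/funext => x; rewrite addrA.
Qed.

Lemma memLSp_cell_bounded2 f h : memLSp pE f -> memLSp pE h ->
  exists c, (forall t, cell_bounded (fun x => f (x + t)) c) /\
            (forall t, cell_bounded (fun x => h (x + t)) c).
Proof.
move=> /memLSp_cell_bounded[c fc] /memLSp_cell_bounded[c' hc'].
exists (Num.max c c'); split => t.
  have [m b] := fc t; split => // k; apply: (lt_le_trans (b k)).
  by rewrite lee_fin le_max lexx.
have [m b] := hc' t; split => // k; apply: (lt_le_trans (b k)).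
by rewrite lee_fin le_max lexx orbT.
Qed.

Lemma kernel_integral_translate_cvg f h (s : nat -> R) (t : R) :
  memLSp pE f -> memLSp pE h ->
  (forall r : R, luxemburg pE (fun x => f (x + s n + r) - h (x + r))
     @[n --> \oo] --> 0%E) ->
  K (fun u => f (u + (s n - t))) @[n --> \oo] --> K (fun u => h (u - t)).
Proof.
move=> mf mh fh; have [c [fc hc]] := memLSp_cell_bounded2 mf mh.
apply: (kernel_integral_cvg (c := c)).
- by move=> n; exact: fc.
- exact: hc.
move=> k; apply: cvg_trans (fh (k%:R - t)); apply: near_eq_cvg.
apply: nearW => n /=; congr (luxemburg _ _); apply/funext => x.
by congr (f _ - h _); ring.
Qed.

(** The substitution u = t - s. *)
Lemma convolutionP f t : memLSp pE f ->
  is_bochner_integral (T := lebesgueR R) leb `]-oo, t[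
    (fun s : R => Rf (t - s) (f (- s))) (K (fun u => f (u - t))).
Proof.
move=> /memLSp_cell_bounded[c fc].
have mpos : measurable pos by exact: leb_measurable_itv.
have := kernel_integrable (fc (- t)).
move=> /(bochner_integralP leb_complete mpos)/(is_bochner_integral_reflect t mpos).
congr (is_bochner_integral _ _ _ _).
  apply/seteqP; split => s /=; rewrite !in_itv/= andbT; lra.
by apply/funext => s; congr (Rf _ (f _)); ring.
Qed.

(** Convergence in the norm with exponent p(x) implies convergence in L^1 on
    each unit interval. *)
Lemma Sp_limit_unique f h (a : nat -> R) : memLSp pE f -> memLSp pE h ->
  a n @[n --> \oo] --> 0 ->
  (forall r : R, luxemburg pE (fun x => f (x + a n + r) - h (x + r))
     @[n --> \oo] --> 0%E) ->
  forall r : R, {ae leb, forall x : R, I01 x -> f (x + r) = h (x + r)}.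
Proof.
move=> [mf _ _] [mh _ _] a0 fh r.
have mfr t := strongly_measurable_shift t mf.
have mhr := strongly_measurable_shift r mh.
apply: (@translate_limit_unique _ _ (fun x => f (x + r)) (fun x => h (x + r)) a _ mhr a0).
  exact: mfr.
apply: cvge0_squeeze => [n|e e0].
  by apply: integral_ge0 => x _; rewrite lee_fin normr_of_ge0.
have e2 : 0 < e / 2 by rewrite divr_gt0.
apply: filterS (cvge0_lt (fh r) e2) => n lux.
rewrite [e in (_ <= e%:E)%E](_ : e = 2 * (e / 2)); last by field.
apply: (luxemburg_L1 hp _ lux).
apply: strongly_measurableB; last exact: strongly_measurable_subset mhr.
have := strongly_measurable_shift (a n) (mfr r).
exact: strongly_measurable_subset.
Qed.

Lemma kernel_integral_ae_eq f h t : memLSp pE f -> memLSp pE h ->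
  (forall r : R, {ae leb, forall x : R, I01 x -> f (x + r) = h (x + r)}) ->
  K (fun u => f (u - t)) = K (fun u => h (u - t)).
Proof.
move=> mf mh fh; have [c [fc hc]] := memLSp_cell_bounded2 mf mh.
have := kernel_integralB_le (fc (- t)) (hc (- t)).
rewrite eseries0 => [|k _ _].
  rewrite lee_fin => K0; apply/eqP; rewrite -subr_eq0; apply/eqP.
  by apply: normr_of_eq0; apply/eqP; rewrite eq_le K0 normr_of_ge0.
rewrite /cell_cost -[RHS](integral0 leb I01).
have mI := @measurable_I01 R.
apply: (ge0_ae_eq_integral mI).
- apply/measurable_EFinP; apply: (measurable_cell_cost (v := fun u => f (u - t) - h (u - t))).
  by apply: strongly_measurableB; [case: (fc (- t))|case: (hc (- t))].
- exact: measurable_cst.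
- by move=> x _; rewrite lee_fin mulr_ge0// ?opnorm_ge0 ?normr_of_ge0.
- by [].
apply: ae_leb_mono (fh (k%:R - t)) => x fhx Ix.
by rewrite -!addrA fhx// subrr normr_of0 mulr0.
Qed.

(** A sequence s n -> 0 violating continuity at t0 would have, by almost
    automorphy, a subsequence along which G (t0 + s n) converges to G t0. *)
Lemma convolution_continuous f : Sp_almost_automorphic pE f ->
  continuous (fun t : R => K (fun u => f (u - t))).
Proof.
move=> [mf aa] t0; set G := fun t => _.
apply/normr_of_cvgP => e e0; apply: contrapT => nG.
have /choice[s sP] (n : nat) : exists s : R,
    `|s| < n.+1%:R^-1 /\ e <= normr_of (G t0 - G (t0 + s)).
  apply: contrapT => ns; apply: nG.
  exists n.+1%:R^-1 => /=; first by rewrite invr_gt0.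
  move=> t /= tt0; rewrite ltNge; apply/negP => Gt.
  apply: ns; exists (t - t0); have -> : t0 + (t - t0) = t by ring.
  by split; [rewrite distrC; exact: tt0|exact: Gt].
have [k [h [kmono mh kh]]] := aa (fun n => - s n).
have k_ge n : (n <= k n)%N.
  by elim: n => // n IHn; apply: (leq_ltn_trans IHn); exact: kmono.
have sk0 : - s (k n) @[n --> \oo] --> 0.
  apply/cvgr0Pnorm_lt => d d0; near=> n; rewrite normrN.
  apply: (lt_trans (sP (k n)).1); apply: (@le_lt_trans _ _ (n.+1%:R^-1)).
    by rewrite lef_pV2 ?posrE ?ltr0n// ler_nat ltnS; exact: k_ge.
  by near: n; exact: near_infty_natSinv_lt (PosNum d0).
have fh (r : R) : luxemburg pE (fun x => f (x + - s (k n) + r) - h (x + r))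
     @[n --> \oo] --> 0%E.
  apply: cvg_trans (kh r).1; apply: near_eq_cvg; apply: nearW => n /=.
  by congr (luxemburg _ _); apply/funext => x; congr (f _ - h _); ring.
have := kernel_integral_translate_cvg (t := t0) mf mh fh.
rewrite -(kernel_integral_ae_eq t0 mf mh (Sp_limit_unique mf mh sk0 fh)).
move=> /normr_of_cvgP/(_ e e0)[N _ /(_ N (leqnn N))]/=.
apply/negP; rewrite -leNgt; have := (sP (k N)).2.
by congr (_ <= normr_of (_ - K _)); apply/funext => u; congr (f _); ring.
Unshelve. all: by end_near. Qed.

Lemma convolution_almost_automorphic f : Sp_almost_automorphic pE f ->
  almost_automorphic (fun t : R => K (fun u => f (u - t))).
Proof.
move=> aaf; split; first exact: convolution_continuous.
have [mf aa] := aaf.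
move=> b; have [k [h [kmono mh kh]]] := aa (fun n => - b n).
have fh (r : R) : luxemburg pE (fun x => f (x + - b (k n) + r) - h (x + r))
     @[n --> \oo] --> 0%E.
  apply: cvg_trans (kh r).1; apply: near_eq_cvg; apply: nearW => n /=.
  by congr (luxemburg _ _); apply/funext => x; congr (f _ - h _); ring.
have hf (r : R) : luxemburg pE (fun x => h (x + b (k n) + r) - f (x + r))
     @[n --> \oo] --> 0%E.
  apply: cvg_trans (kh r).2; apply: near_eq_cvg; apply: nearW => n /=.
  by congr (luxemburg _ _); apply/funext => x; congr (h _ - f _); ring.
exists k, (fun t => K (fun u => h (u - t))); split => // t; split.
  apply: cvg_trans (kernel_integral_translate_cvg (t := t) mf mh fh).
  apply: near_eq_cvg; apply: nearW => n /=; congr (kernel_integral _).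
  by apply/funext => u; congr (f _); ring.
apply: cvg_trans (kernel_integral_translate_cvg (t := t) mh mf hf).
apply: near_eq_cvg; apply: nearW => n /=; congr (kernel_integral _).
by apply/funext => u; congr (h _); ring.
Qed.

End kernel_integral.

Unset Implicit Arguments.
Set Strict Implicit.

Theorem proposition5p1 (R : realType) (X Y : completeNormedModType R[i])
  (p : R -> R) (q : R -> \bar R)
  (hp : exponent_Dplus p) (hq : exponent_P q)
  (hpq : {ae leb, forall x : R, I01 x -> ((p x)^-1%:E + (q x)^-1 = 1)%E})
  (Rf : R -> {linear X -> Y})
  (Rf_bounded : forall t : R, 0 < t -> continuous (Rf t))
  (Rf_strongly_continuous :
     forall (x : X) (t : R), 0 < t -> {for t, continuous (fun s : R => Rf s x)})
  (Rf_summable :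
     (\sum_(0 <= k <oo)
        luxemburg q (fun x : R => (opnorm (Rf (x + k%:R)%R))%:C : R[i]^o)
      < +oo)%E)
  (g : R -> X)
  (hg : Sp_almost_automorphic (fun x => (p x)%:E) (fun t => g (- t))) :
  let G (t : R) :=
    bochner_integral leb `]-oo, t[ (fun s : R => Rf (t - s) (g s)) in
  (forall t : R,
     bochner_integrable leb `]-oo, t[ (fun s : R => Rf (t - s) (g s))) /\
  almost_automorphic G.
Proof.
move=> G; have [mg _] := hg.
have GP t : is_bochner_integral leb `]-oo, t[ (fun s : R => Rf (t - s) (g s))
    (kernel_integral Rf (fun u => g (- (u - t)))).
  have := convolutionP hp hq hpq Rf_bounded Rf_strongly_continuous Rf_summable t mg.
  by congr (is_bochner_integral _ _ _ _); apply/funext => s; rewrite /= opprK.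
split=> [t|]; first by have [mF [s sF _]] := GP t; split => //; exists s.
have -> : G = (fun t => kernel_integral Rf (fun u => g (- (u - t)))).
  apply/funext => t; apply: (bochner_integral_unique leb_complete _ (GP t)).
  exact: leb_measurable_itv.
exact: (convolution_almost_automorphic hp hq hpq Rf_bounded
  Rf_strongly_continuous Rf_summable hg).
Qed.
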